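(* Let $\chi$ be a primitive real Dirichlet character modulo $q$, let $\beta_0$ be the exceptional zero of $L(s,\chi)$, and let $\sigma\in(\beta_0,1)$. (i) If $\chi$ is odd, $q>4\cdot 10^5$ and $\beta_0\ge 1-\frac{800}{\sqrt{q}\,\log^2 q}$, then $|L'(\sigma,\chi)|\le 0.18\,\log^2 q$. (ii) If $\chi$ is even, $q>4\cdot 10^5$ and $\beta_0\ge 1-\frac{515}{\sqrt{q}\,\log^2 q}$, then $|L'(\sigma,\chi)|\le 0.1536\,\log^2 q$. (iii) If $\chi$ is even, $q>10^7$ and $\beta_0\ge 1-\frac{80}{\sqrt{q}\,\log^2 q}$, then $|L'(\sigma,\chi)|\le 0.15\,\log^2 q$.
   Context: For a Dirichlet character $\chi$ modulo $q$, $L(s,\chi)=\sum_{n\ge 1}\chi(n)n^{-s}$ is its Dirichlet $L$-function; for non-principal $\chi$ this series converges for $\Re(s)>0$, and $L'(\sigma,\chi)=\frac{d}{d\sigma}L(\sigma,\chi)=-\sum_{n\ge1}\chi(n)\frac{\log n}{n^{\sigma}}$ for real $\sigma>0$. The character $\chi$ is even if $\chi(-1)=1$ and odd if $\chi(-1)=-1$; it is real if it takes only real values. $\log^2 q$ means $(\log q)^2$. Exceptional zero: with $R_0=9.6459$, it is known (McCurley) that $\Pi(s,q):=\prod_{\chi \bmod q}L(s,\chi)$ has at most one zero $\rho=\beta+it$ in the region $\beta\ge 1-(R_0\log\max\{q,q|t|,10\})^{-1}$; if it exists, this zero is real and simple and is a zero of $L(s,\chi)$ for a non-principal real character $\chi$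 modulo $q$. It is called the exceptional zero and denoted $\beta_0$ (so $\beta_0<1$). The statement concerns characters $\chi$ for which such a zero exists. *)

(* Defs.v *)
(* Classical reals of the standard library, with Coquelicot. *)
From Stdlib Require Import Reals ZArith.
From Coquelicot Require Import Coquelicot.
Open Scope R_scope.

(* Characters are functions on all of Z, so that [chi (-1)] makes sense. *)
Definition dirichlet_character (q : Z) (chi : Z -> C) : Prop :=
  (0 < q)%Z /\
  (forall n : Z, chi (n + q)%Z = chi n) /\
  (forall m n : Z, chi (m * n)%Z = (chi m * chi n)%C) /\
  (forall n : Z, chi n <> RtoC 0 <-> Z.gcd n q = 1%Z).

Definition induced_from (q d : Z) (chi : Z -> C) : Prop :=
  exists psi : Z -> C, dirichlet_character d psi /\
    forall n : Z, Z.gcd n q = 1%Z -> chi n = psi n.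

Definition primitive_character (q : Z) (chi : Z -> C) : Prop :=
  dirichlet_character q chi /\
  forall d : Z, (0 < d < q)%Z -> (d | q)%Z -> ~ induced_from q d chi.

Definition real_character (chi : Z -> C) : Prop := forall n : Z, Im (chi n) = 0.

Definition even_character (chi : Z -> C) : Prop := chi (-1)%Z = RtoC 1.

Definition odd_character (chi : Z -> C) : Prop := chi (-1)%Z = RtoC (-1).

(* n^(-s) = exp (- s ln n) = n^(-Re s) (cos (Im s ln n) - i sin (Im s ln n)),
   for n >= 1. *)
Definition nat_cpow_opp (n : nat) (s : C) : C :=
  (Rpower (INR n) (- Re s) * cos (Im s * ln (INR n)),
   - (Rpower (INR n) (- Re s) * sin (Im s * ln (INR n)))).

(* [Series] is indexed from 0, hence the shift. The value is meaningful where
   the series converges, which for a non-principal character includes the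
   half-plane Re s > 0. *)
Definition L_function (chi : Z -> C) (s : C) : C :=
  let term (k : nat) := (chi (Z.of_nat (S k)) * nat_cpow_opp (S k) s)%C in
  (Series (fun k => Re (term k)), Series (fun k => Im (term k))).

(* Derivative along the real axis of the complex-valued sigma |-> L(sigma, chi). *)
Definition L_derivative (chi : Z -> C) (sigma : R) : C :=
  (Derive (fun x : R => Re (L_function chi (RtoC x))) sigma,
   Derive (fun x : R => Im (L_function chi (RtoC x))) sigma).

Definition R0 : R := 9.6459.

Definition mccurley_region (q : Z) (s : C) : Prop :=
  Re s >= 1 - / (R0 * ln (Rmax (Rmax (IZR q) (IZR q * Rabs (Im s))) 10)).

(* By McCurley's theorem the product of the L(s, psi) over all characters psi
   mod q has at most one zero in the region, necessarily real and a zero of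
   L(s, chi) for a non-principal real chi; for such a chi, beta below is that
   zero. *)
Definition exceptional_zero (q : Z) (chi : Z -> C) (beta : R) : Prop :=
  mccurley_region q (RtoC beta) /\ L_function chi (RtoC beta) = RtoC 0.

(* Main.v *)
(* Write r = Re chi, g(t) = t^(-x) (log t - c) with c = log q / 4 + 1, and P(x) = sum r(n) n^(-x).
   Since P' + c P = - sum r(n) g(n) and P(beta0) = 0 with beta0 close to 1, a bound B for that sum
   gives |P'| <= B (1 + c (1 - beta0)). Subtracting c makes the weights |log n - c| / n with
   n < M about half as heavy: for M of size 2 sqrt q they sum to about (log q)^2 / 16
   instead of (log q)^2 / 8. Beyond M the character is averaged over H ~ sqrt q shifts, and the
   double sums of r(M + x + y) over x < H and y < t are at most sqrt (q H t), because Gauss sums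
   of primitive characters have modulus sqrt q (Parseval and Cauchy-Schwarz). No logarithm is lost
   there, unlike in the Polya-Vinogradov inequality, and the parity of chi plays no role. *)
Require Import Defs.
From Stdlib Require Import Reals ZArith.
From Stdlib Require Import Znumtheory List Permutation Lia Lra Psatz Classical ClassicalEpsilon.
From Coquelicot Require Import Coquelicot.
Open Scope R_scope.

(** * Finite sums *)

(** The shift [c] comes from a minimisation. Up to a bounded term, the bound is [c + (log M - c)^2 /
    2 + (c - log (3/2))^2 / 2 + 1.93 (log M - c)] with [log M] close to [log q / 2 + log 2]; the
    last term is the cost of the range beyond [M]. As a function of [c] it is smallest near
    [log q / 4 + 1]. The averaging over shifts costs [H g(M)], and the window sums cost about
    [sqrt (q / (H M))] times [log M - c]. Taking both [H] and [M] of size [sqrt q] keeps each of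
    these of order [log q]. At [q = 4 * 10^5] such lower-order terms still make up more than half of
    the bound, so their constants have to be tracked. *)

Fixpoint rsum (f : nat -> R) (n : nat) : R :=
  match n with O => 0 | S k => rsum f k + f k end.

Lemma rsum_ext (f g : nat -> R) (n : nat) :
  (forall i, (i < n)%nat -> f i = g i) -> rsum f n = rsum g n.
Proof.
intros h; induction n as [|n IH]; simpl; auto.
rewrite IH, h by (auto with arith); auto.
Qed.

Lemma rsum_0 (f : nat -> R) (n : nat) :
  (forall i, (i < n)%nat -> f i = 0) -> rsum f n = 0.
Proof.
intros h; induction n as [|n IH]; simpl; auto.
rewrite IH, h by (auto with arith); ring.
Qed.

Lemma rsum_plus (f g : nat -> R) (n : nat) :
  rsum (fun i => f i + g i) n = rsum f n + rsum g n.
Proof. induction n as [|n IH]; simpl; [|rewrite IH]; ring. Qed.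

Lemma rsum_minus (f g : nat -> R) (n : nat) :
  rsum (fun i => f i - g i) n = rsum f n - rsum g n.
Proof. induction n as [|n IH]; simpl; [|rewrite IH]; ring. Qed.

Lemma rsum_scal (c : R) (f : nat -> R) (n : nat) :
  rsum (fun i => c * f i) n = c * rsum f n.
Proof. induction n as [|n IH]; simpl; [|rewrite IH]; ring. Qed.

Lemma rsum_const (c : R) (n : nat) : rsum (fun _ => c) n = INR n * c.
Proof. induction n as [|n IH]; [simpl|rewrite S_INR; simpl; rewrite IH]; ring. Qed.

Lemma rsum_le (f g : nat -> R) (n : nat) :
  (forall i, (i < n)%nat -> f i <= g i) -> rsum f n <= rsum g n.
Proof.
intros h; induction n as [|n IH]; simpl; [lra|].
assert (f n <= g n) by auto with arith.
assert (rsum f n <= rsum g n) by auto with arith; lra.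
Qed.

Lemma rsum_abs (f : nat -> R) (n : nat) :
  Rabs (rsum f n) <= rsum (fun i => Rabs (f i)) n.
Proof.
induction n as [|n IH]; simpl; [rewrite Rabs_R0; lra|].
pose proof (Rabs_triang (rsum f n) (f n)); lra.
Qed.

Lemma rsum_exchange (f : nat -> nat -> R) (m n : nat) :
  rsum (fun i => rsum (f i) n) m = rsum (fun j => rsum (fun i => f i j) m) n.
Proof.
induction m as [|m IH]; simpl.
- symmetry; apply rsum_0; auto.
- rewrite IH, <- rsum_plus; apply rsum_ext; auto.
Qed.

Lemma rsum_add (f : nat -> R) (m n : nat) :
  rsum f (m + n) = rsum f m + rsum (fun i => f (m + i)%nat) n.
Proof.
induction n as [|n IH]; simpl; [rewrite Nat.add_0_r; ring|].
rewrite Nat.add_succ_r; simpl; rewrite IH; ring.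
Qed.

Lemma rsum_pos (f : nat -> R) (i n : nat) :
  (i < n)%nat -> (forall j, 0 <= f j) -> 0 < f i -> 0 < rsum f n.
Proof.
intros hi h fi.
assert (pos : forall m, 0 <= rsum f m).
{ intros m; rewrite <- (rsum_0 (fun _ => 0) m) by auto; apply rsum_le; auto. }
induction n as [|n IH]; [lia|simpl].
pose proof (pos n); pose proof (h n).
destruct (Nat.eq_dec i n) as [->|ne]; [lra|].
assert (0 < rsum f n) by (apply IH; lia); lra.
Qed.

Lemma rsum_mul (f g : nat -> R) (m n : nat) :
  rsum f m * rsum g n = rsum (fun i => rsum (fun j => f i * g j) n) m.
Proof.
rewrite Rmult_comm, <- rsum_scal; apply rsum_ext; intros i _.
rewrite rsum_scal; ring.
Qed.

(** Gives access to permutations of lists, for the change of variable in [rsum_unit]. *)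
Lemma rsum_fold (f : nat -> R) (n : nat) :
  rsum f n = fold_right Rplus 0 (map f (seq 0 n)).
Proof.
induction n as [|n IH]; auto.
rewrite seq_S, map_app, fold_right_app; simpl rsum; rewrite IH; simpl.
generalize (map f (seq 0 n)); intros l.
replace (f n + 0) with (f n) by ring.
induction l as [|a l IHl]; simpl; [|rewrite <- IHl]; ring.
Qed.

Lemma fold_Rplus_perm (l l' : list R) :
  Permutation l l' -> fold_right Rplus 0 l = fold_right Rplus 0 l'.
Proof. induction 1; simpl; lra. Qed.

(** The form [sum (s f - t g)^2] is nonnegative for all [s] and [t]; two evaluations of it
    suffice. *)
Lemma rsum_cauchy_schwarz (f g : nat -> R) (n : nat) :
  (rsum (fun i => f i * g i) n) ^ 2
  <= rsum (fun i => f i ^ 2) n * rsum (fun i => g i ^ 2) n.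
Proof.
set (b := rsum (fun i => f i * g i) n).
set (a := rsum (fun i => f i ^ 2) n).
set (d := rsum (fun i => g i ^ 2) n).
assert (q : forall s t, 0 <= s ^ 2 * a - 2 * s * t * b + t ^ 2 * d).
{ intros s t; unfold a, b, d.
  rewrite <- !rsum_scal, <- rsum_minus, <- rsum_plus.
  rewrite <- (rsum_0 (fun _ => 0) n) by auto.
  apply rsum_le; intros i _.
  replace (_ - _ + _) with ((s * f i - t * g i) ^ 2) by ring; apply pow2_ge_0. }
assert (0 <= a).
{ specialize (q 1 0); lra. }
assert (0 <= d).
{ specialize (q 0 1); lra. }
destruct (Req_dec d 0) as [d0|dn].
- rewrite d0 in *.
  (* With [d = 0] the form equals [- b ^ 2 * (a + 2)] here, so [b = 0]. *)
  specialize (q b (1 + a)); nra.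
- specialize (q d b); nra.
Qed.

(** * Residues and primitive characters *)

Lemma periodic_eq (q : Z) (A : Type) (f : Z -> A) (a b : Z) :
  (forall n, f (n + q)%Z = f n) -> (q | a - b)%Z -> f a = f b.
Proof.
intros per [k e].
assert (nk : forall m (n : Z), f (n + Z.of_nat m * q)%Z = f n).
{ induction m as [|m IH]; intros n; [f_equal; lia|].
  rewrite <- (IH n), <- (per (n + Z.of_nat m * q)%Z); f_equal; lia. }
destruct (Z_le_gt_dec 0 k).
- rewrite <- (nk (Z.to_nat k) b), Z2Nat.id by lia; f_equal; lia.
- rewrite <- (nk (Z.to_nat (- k)) a), Z2Nat.id by lia; f_equal; lia.
Qed.

Lemma gcd1_div (q u a : Z) : Z.gcd u q = 1%Z -> (q | u * a)%Z -> (q | a)%Z.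
Proof.
intros g d; apply (Z.gauss _ u); auto; rewrite Z.gcd_comm; auto.
Qed.

Lemma rsum_mod (f : nat -> R) (N t : nat) :
  N <> 0%nat -> (forall i, f (N + i)%nat = f i) -> rsum f N = 0 ->
  rsum f t = rsum f (t mod N).
Proof.
intros N0 per z.
assert (red : forall k s, rsum f (k * N + s) = rsum f s).
{ induction k as [|k IH]; intros s; auto.
  replace (S k * N + s)%nat with (N + (k * N + s))%nat by lia.
  rewrite rsum_add, z, <- IH, Rplus_0_l; apply rsum_ext; auto. }
rewrite (Nat.div_mod t N) at 1 by auto; rewrite (Nat.mul_comm N); apply red.
Qed.

Lemma gcd_mul_1 (a b n : Z) :
  Z.gcd a n = 1%Z -> Z.gcd b n = 1%Z -> Z.gcd (a * b) n = 1%Z.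
Proof.
intros ha hb; apply Zgcd_1_rel_prime, rel_prime_sym, rel_prime_mult;
  apply rel_prime_sym, Zgcd_1_rel_prime; auto.
Qed.

Lemma gcd_div_1 (a b n : Z) : (a | b)%Z -> Z.gcd b n = 1%Z -> Z.gcd a n = 1%Z.
Proof.
intros d h; apply Zgcd_1_rel_prime, (rel_prime_div b); auto.
apply Zgcd_1_rel_prime; auto.
Qed.

Section residues.

Variable q : Z.
Hypothesis q_pos : (0 < q)%Z.

(** Multiplication by a unit is injective on residues, and a duplicate-free list of [q] residues is
    a permutation of all of them. *)
Lemma rsum_unit (f : Z -> R) (u : Z) :
  (forall n, f (n + q)%Z = f n) -> Z.gcd u q = 1%Z ->
  rsum (fun a => f (u * Z.of_nat a)%Z) (Z.to_nat q)
  = rsum (fun a => f (Z.of_nat a)) (Z.to_nat q).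
Proof.
intros per g.
set (h := fun a => ((u * Z.of_nat a) mod q)%Z).
rewrite (rsum_ext _ (fun a => f (h a))).
2:{ intros i _; apply (periodic_eq q); auto; unfold h.
    exists ((u * Z.of_nat i) / q)%Z.
    pose proof (Z.div_mod (u * Z.of_nat i) q); lia. }
rewrite !rsum_fold, <- (map_map h f), <- (map_map Z.of_nat f).
apply fold_Rplus_perm, Permutation_map, NoDup_Permutation_bis.
- apply NoDup_map_NoDup_ForallPairs; [|apply seq_NoDup].
  intros i j hi hj e; apply in_seq in hi; apply in_seq in hj.
  assert (d : (q | Z.of_nat i - Z.of_nat j)%Z).
  { apply (gcd1_div q u); auto; unfold h in e.
    exists ((u * Z.of_nat i) / q - (u * Z.of_nat j) / q)%Z.
    pose proof (Z.div_mod (u * Z.of_nat i) q).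
    pose proof (Z.div_mod (u * Z.of_nat j) q). lia. }
  destruct d as [k d]; assert (k = 0)%Z by nia; lia.
- rewrite !length_map; lia.
- intros z hz; apply in_map_iff in hz; destruct hz as [i [<- _]].
  pose proof (Z.mod_pos_bound (u * Z.of_nat i) q q_pos).
  apply in_map_iff; exists (Z.to_nat (h i)); unfold h in *; split; [lia|].
  apply in_seq; lia.
Qed.

Lemma bounded_max (P : Z -> Prop) (k : Z) :
  P k -> (forall j, P j -> (j <= q)%Z) ->
  exists m, P m /\ forall j, P j -> (j <= m)%Z.
Proof.
intros Pk bd.
assert (H : forall n k, P k -> (q - k <= Z.of_nat n)%Z ->
  exists m, P m /\ forall j, P j -> (j <= m)%Z).
{ induction n as [|n IH]; intros k0 P0 le.
  - exists k0; split; auto; intros j Pj; specialize (bd j Pj); lia.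
  - destruct (classic (exists j, P j /\ (k0 < j)%Z)) as [[j [Pj lt]]|no].
    + apply (IH j); auto; lia.
    + exists k0; split; auto; intros j Pj.
      destruct (Z_le_gt_dec j k0); auto; exfalso; apply no; exists j; split; auto; lia. }
apply (H (Z.to_nat (q - k)) k); auto; pose proof (bd k Pk); lia.
Qed.

(* Shift [n] by [d] times the largest divisor of [q] prime to [n]. *)
Lemma coprime_lift (d n : Z) :
  Z.gcd n d = 1%Z -> exists m, (d | m - n)%Z /\ Z.gcd m q = 1%Z.
Proof.
intros g.
destruct (bounded_max (fun k => (k | q)%Z /\ Z.gcd k n = 1%Z) 1) as [k [[kq kn] mx]].
{ split; [exists q; lia|apply Z.gcd_1_l]. }
{ intros j [hj _]; apply Z.divide_pos_le; auto. }
assert (k1 : (1 <= k)%Z).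
{ apply mx; split; [exists q; lia|apply Z.gcd_1_l]. }
exists (n + d * k)%Z; split; [exists k; ring|].
set (e := Z.gcd (n + d * k) q).
assert (e0 : (0 < e)%Z).
{ assert (e <> 0)%Z by (intros h; apply Z.gcd_eq_0_r in h; lia).
  pose proof (Z.gcd_nonneg (n + d * k) q); unfold e in *; lia. }
assert (em : (e | n + d * k)%Z) by apply Z.gcd_divide_l.
assert (eq : (e | q)%Z) by apply Z.gcd_divide_r.
(* A common divisor of [e] and [n] divides [d * k], is prime to [d], hence divides [k], which is
   prime to [n]. *)
assert (en : Z.gcd e n = 1%Z).
{ set (f := Z.gcd e n).
  assert (fe : (f | e)%Z) by apply Z.gcd_divide_l.
  assert (fn : (f | n)%Z) by apply Z.gcd_divide_r.
  assert (fdk : (f | d * k)%Z).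
  { replace (d * k)%Z with ((n + d * k) - n)%Z by ring.
    apply Z.divide_sub_r; auto; apply (Z.divide_trans _ e); auto. }
  assert (fd : Z.gcd f d = 1%Z) by (apply (gcd_div_1 _ n); auto).
  assert (fk : (f | k)%Z) by (apply (Z.gauss _ d); auto).
  assert (f1 : (f | 1)%Z) by (rewrite <- kn; apply Z.gcd_greatest; auto).
  apply Z.divide_1_r_nonneg; auto; apply Z.gcd_nonneg. }
(* The lcm is again a divisor of [q] prime to [n], so maximality of [k] forces [e | k]; then [e]
   divides [n], and [e = 1] by [en]. *)
assert (lk : (Z.lcm k e <= k)%Z).
{ apply mx; split; [apply Z.lcm_least; auto|].
  apply (gcd_div_1 _ (k * e)); [|apply gcd_mul_1; auto].
  apply Z.lcm_least; [exists e; ring|exists k; ring]. }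
assert (ek : (e | k)%Z).
{ pose proof (Z.divide_lcm_l k e) as dl.
  assert (0 < Z.lcm k e)%Z.
  { pose proof (Z.lcm_nonneg k e).
    assert (Z.lcm k e <> 0)%Z by (rewrite Z.lcm_eq_0; lia). lia. }
  apply Z.divide_pos_le in dl; auto.
  replace k with (Z.lcm k e) at 1 by lia; apply Z.divide_lcm_r. }
assert (en' : (e | n)%Z).
{ replace n with ((n + d * k) - d * k)%Z by ring.
  apply Z.divide_sub_r; auto; apply Z.divide_mul_r; auto. }
rewrite <- en; symmetry; apply Z.divide_gcd_iff; auto; lia.
Qed.

End residues.

Lemma chi_one (q : Z) (chi : Z -> C) :
  dirichlet_character q chi -> chi 1%Z = RtoC 1.
Proof.
intros [_ [_ [mu nz]]].
assert (n1 : chi 1%Z <> RtoC 0) by (apply nz, Z.gcd_1_l).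
pose proof (mu 1%Z 1%Z) as e; rewrite Z.mul_1_r in e.
assert (e' : (chi 1%Z * chi 1%Z * / chi 1%Z = chi 1%Z * / chi 1%Z)%C) by (rewrite <- e; auto).
rewrite <- Cmult_assoc, !Cinv_r, Cmult_1_r in e'; auto.
Qed.

(** If [chi] were 1 on all units congruent to 1 modulo [d], its value at a unit would depend only on
    the class modulo [d], and [chi] would be induced from [d]. *)
Lemma primitive_separates (q : Z) (chi : Z -> C) (d : Z) :
  primitive_character q chi -> (0 < d < q)%Z -> (d | q)%Z ->
  exists u, Z.gcd u q = 1%Z /\ (d | u - 1)%Z /\ chi u <> RtoC 1.
Proof.
intros [dc prim] hd dq; apply NNPP; intros no.
assert (tr : forall u, Z.gcd u q = 1%Z -> (d | u - 1)%Z -> chi u = RtoC 1).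
{ intros u h1 h2; apply NNPP; intros h3; apply no; exists u; auto. }
pose proof (chi_one _ _ dc) as c1.
destruct dc as [q0 [per [mu nz]]].
(* With [u] inverse to [m] modulo [q], the product [u * n] is congruent to 1 modulo [d], so [chi] is
   1 at both [u * m] and [u * n]. *)
assert (same : forall m n, Z.gcd m q = 1%Z -> Z.gcd n q = 1%Z -> (d | m - n)%Z ->
  chi m = chi n).
{ intros m n hm hn dmn.
  assert (rp : rel_prime m q) by (apply Zgcd_1_rel_prime; auto).
  apply rel_prime_bezout in rp; destruct rp as [u v e].
  assert (um : chi (u * m)%Z = RtoC 1).
  { rewrite <- c1; apply (periodic_eq q); auto; exists (- v)%Z; lia. }
  assert (gu : Z.gcd u q = 1%Z).
  { apply Zgcd_1_rel_prime, bezout_rel_prime, (Bezout_intro _ _ _ m v); lia. }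
  assert (un : chi (u * n)%Z = RtoC 1).
  { apply tr; [apply gcd_mul_1; auto|].
    destruct dmn as [k ek]; destruct dq as [l el].
    exists (- u * k - v * l)%Z.
    replace (u * n)%Z with (u * m - u * (m - n))%Z by ring; nia. }
  rewrite mu in um, un.
  assert (nu : chi u <> RtoC 0) by (apply nz; auto).
  assert (e' : (/ chi u * (chi u * chi m) = / chi u * (chi u * chi n))%C)
    by (rewrite um, un; auto).
  rewrite !Cmult_assoc, Cinv_l, !Cmult_1_l in e'; auto. }
(* A unit modulo [d] need not be prime to [q], so [psi] is read off at a chosen representative that
   is; [same] makes the choice immaterial. *)
pose (lift := fun n => epsilon (inhabits 0%Z) (fun m => (d | m - n)%Z /\ Z.gcd m q = 1%Z)).
assert (lift_spec : forall n, Z.gcd n d = 1%Z ->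
  (d | lift n - n)%Z /\ Z.gcd (lift n) q = 1%Z).
{ intros n g; unfold lift; apply epsilon_spec, coprime_lift; auto. }
pose (psi := fun n => if Z.eq_dec (Z.gcd n d) 1 then chi (lift n) else RtoC 0).
assert (psi1 : forall n, Z.gcd n d = 1%Z -> psi n = chi (lift n)).
{ intros n g; unfold psi; destruct (Z.eq_dec (Z.gcd n d) 1); tauto. }
assert (psi0 : forall n, Z.gcd n d <> 1%Z -> psi n = RtoC 0).
{ intros n g; unfold psi; destruct (Z.eq_dec (Z.gcd n d) 1); tauto. }
apply (prim d); auto.
exists psi; split.
- split; [lia|split; [|split]].
  + intros n.
    assert (e : Z.gcd (n + d) d = Z.gcd n d).
    { rewrite Z.gcd_comm, Z.gcd_add_diag_r, Z.gcd_comm; auto. }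
    destruct (Z.eq_dec (Z.gcd n d) 1) as [g|g].
    * rewrite !psi1 by lia.
      destruct (lift_spec n g) as [[k hk] ?].
      destruct (lift_spec (n + d)%Z) as [[l hl] ?]; [lia|].
      apply same; auto; exists (l + 1 - k)%Z; lia.
    * rewrite !psi0 by lia; auto.
  + intros m n.
    destruct (Z.eq_dec (Z.gcd m d) 1) as [gm|gm];
    [destruct (Z.eq_dec (Z.gcd n d) 1) as [gn|gn]|].
    * assert (g : Z.gcd (m * n) d = 1%Z) by (apply gcd_mul_1; auto).
      rewrite !psi1, <- mu by auto.
      destruct (lift_spec m gm) as [[k hk] ?].
      destruct (lift_spec n gn) as [[l hl] ?].
      destruct (lift_spec (m * n)%Z g) as [[j hj] ?].
      apply same; auto; [apply gcd_mul_1; auto|].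
      exists (j - k * lift n - m * l)%Z.
      replace (lift m) with (k * d + m)%Z by lia.
      replace (lift n) with (l * d + n)%Z in * by lia. nia.
    * rewrite (psi0 n), Cmult_0_r by auto; apply psi0; intros h; apply gn.
      apply (gcd_div_1 _ (m * n)); auto; exists m; ring.
    * rewrite (psi0 m), Cmult_0_l by auto; apply psi0; intros h; apply gm.
      apply (gcd_div_1 _ (m * n)); auto; exists n; ring.
  + intros n; destruct (Z.eq_dec (Z.gcd n d) 1) as [g|g].
    * rewrite psi1, nz by auto; destruct (lift_spec n g); tauto.
    * rewrite psi0 by auto; tauto.
- intros n g.
  assert (gd : Z.gcd n d = 1%Z).
  { rewrite Z.gcd_comm in *; apply (gcd_div_1 _ q); auto. }
  rewrite psi1 by auto; destruct (lift_spec n gd) as [[k hk] ?].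
  apply same; auto; exists (- k)%Z; lia.
Qed.

(** [pq_separates] is the form in which primitivity is used: it makes the Gauss sum at a non-unit
    equal to its own opposite. *)
Record primitive_quadratic (q : Z) (r : Z -> R) : Prop := {
  pq_gt1 : (1 < q)%Z;
  pq_periodic : forall n, r (n + q)%Z = r n;
  pq_mul : forall m n, r (m * n)%Z = r m * r n;
  pq_one : r 1%Z = 1;
  pq_zero : forall n, Z.gcd n q <> 1%Z -> r n = 0;
  pq_unit : forall n, Z.gcd n q = 1%Z -> r n ^ 2 = 1;
  pq_separates : forall n, Z.gcd n q <> 1%Z ->
    exists u, Z.gcd u q = 1%Z /\ (q | u * n - n)%Z /\ r u = -1 }.

Lemma primitive_quadratic_Re (q : Z) (chi : Z -> C) :
  (1 < q)%Z -> primitive_character q chi -> real_character chi ->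
  primitive_quadratic q (fun n => Re (chi n)).
Proof.
intros q1 prim re.
pose proof (proj1 prim) as dc; pose proof (chi_one _ _ dc) as c1.
destruct dc as [q0 [per [mu nz]]].
assert (rc : forall n, chi n = RtoC (Re (chi n))).
{ intros n; apply injective_projections; auto; apply (re n). }
assert (r_mul : forall m n, Re (chi (m * n)%Z) = Re (chi m) * Re (chi n)).
{ intros m n; rewrite mu; unfold Cmult, Re; simpl.
  specialize (re m); unfold Im in re; rewrite re; ring. }
(* The substitution [a -> u a] preserves the sum of squares over a period and also multiplies it by
   [f u]; the sum is positive, so [f u = 1]. *)
assert (r_unit : forall n, Z.gcd n q = 1%Z -> Re (chi n) ^ 2 = 1).
{ intros u g.
  set (f := fun n => Re (chi n) ^ 2).
  assert (e : rsum (fun a => f (u * Z.of_nat a)%Z) (Z.to_nat q)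
              = rsum (fun a => f (Z.of_nat a)) (Z.to_nat q)).
  { apply rsum_unit; auto; intros n; unfold f; rewrite per; auto. }
  rewrite (rsum_ext _ (fun a => f u * f (Z.of_nat a))), rsum_scal in e.
  2:{ intros i _; unfold f; rewrite r_mul; ring. }
  assert (0 < rsum (fun a => f (Z.of_nat a)) (Z.to_nat q)).
  { apply (rsum_pos _ 1); [lia|intros; apply pow2_ge_0|].
    change (0 < f 1%Z); unfold f; rewrite c1; simpl; lra. }
  unfold f in *; nra. }
constructor; auto.
- intros n; rewrite per; auto.
- rewrite c1; auto.
- intros n g; destruct (classic (chi n = RtoC 0)) as [h|h]; [rewrite h; auto|].
  apply nz in h; tauto.
- intros n g.
  assert (g0 : (0 < Z.gcd n q)%Z).
  { pose proof (Z.gcd_nonneg n q).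
    assert (Z.gcd n q <> 0)%Z by (intros h; apply Z.gcd_eq_0_r in h; lia). lia. }
  destruct (Z.gcd_divide_l n q) as [k ek].
  destruct (Z.gcd_divide_r n q) as [d ed].
  (* Here [d = q / gcd (n, q)]: if [u] is 1 modulo [d], then [u * n] is [n] modulo [q]. *)
  destruct (primitive_separates q chi d prim) as [u [gu [[l el] nu]]].
  { nia. }
  { exists (Z.gcd n q); lia. }
  exists u; split; [auto|split].
  + exists (l * k)%Z; nia.
  + pose proof (r_unit u gu).
    assert (Re (chi u) <> 1) by (intros h; apply nu; rewrite rc, h; auto).
    assert ((Re (chi u) - 1) * (Re (chi u) + 1) = 0) by lra.
    apply Rmult_integral in H1; destruct H1; lra.
Qed.

(** * Gauss sums *)

Definition angle (q k : Z) : R := 2 * PI * IZR k / IZR q.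

Lemma angle_plus (q m n : Z) : angle q (m + n) = angle q m + angle q n.
Proof. unfold angle; rewrite plus_IZR; unfold Rdiv; ring. Qed.

Lemma angle_minus (q m n : Z) : angle q (m - n) = angle q m - angle q n.
Proof. unfold angle; rewrite minus_IZR; unfold Rdiv; ring. Qed.

Lemma angle_q (q : Z) : (0 < q)%Z -> angle q q = 2 * PI.
Proof. intros h; unfold angle; apply IZR_lt in h; field; lra. Qed.

Lemma cos_angle_periodic (q n : Z) : (0 < q)%Z -> cos (angle q (n + q)) = cos (angle q n).
Proof. intros h; rewrite angle_plus, angle_q, cos_plus, cos_2PI, sin_2PI by auto; ring. Qed.

Lemma sin_angle_periodic (q n : Z) : (0 < q)%Z -> sin (angle q (n + q)) = sin (angle q n).
Proof. intros h; rewrite angle_plus, angle_q, sin_plus, cos_2PI, sin_2PI by auto; ring. Qed.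

Lemma dirichlet_kernel (x : R) (n : nat) :
  2 * sin (x / 2) * rsum (fun a => cos (INR a * x)) n
  = sin (INR n * x - x / 2) + sin (x / 2).
Proof.
induction n as [|n IH].
- simpl; replace (0 * x - x / 2) with (- (x / 2)) by ring; rewrite sin_neg; ring.
- rewrite S_INR; simpl rsum; rewrite Rmult_plus_distr_l, IH.
  replace ((INR n + 1) * x - x / 2) with (INR n * x + x / 2) by field.
  rewrite sin_plus, sin_minus; ring.
Qed.

Lemma cos_orthogonality (q h : Z) :
  (- q < h < q)%Z ->
  rsum (fun a => cos (angle q (Z.of_nat a * h))) (Z.to_nat q)
  = if Z.eq_dec h 0 then IZR q else 0.
Proof.
intros hh; assert (q0 : (0 < q)%Z) by lia.
assert (Rq : 0 < IZR q) by (apply IZR_lt; auto).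
destruct (Z.eq_dec h 0) as [->|n0].
- rewrite (rsum_ext _ (fun _ => 1)).
  + rewrite rsum_const, INR_IZR_INZ, Z2Nat.id by lia; ring.
  + intros i _; rewrite Z.mul_0_r; unfold angle.
    replace (2 * PI * 0 / IZR q) with 0 by (field; lra); apply cos_0.
- pose proof (dirichlet_kernel (angle q h) (Z.to_nat q)) as e.
  rewrite INR_IZR_INZ, Z2Nat.id in e by lia.
  assert (s : sin (IZR q * angle q h - angle q h / 2) = - sin (angle q h / 2)).
  { rewrite <- sin_neg.
    (* [angle 1 n] is [2 * PI * n], so removing [h] full turns is an instance of [periodic_eq] with
       period 1. *)
    pose (f := fun n => sin (angle 1 n - angle q h / 2)).
    transitivity (f h).
    - unfold f, angle; f_equal; field; lra.
    - transitivity (f 0%Z).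
      + apply (periodic_eq 1 R f h 0%Z); [|exists h; lia].
        intros n; unfold f; rewrite angle_plus, (angle_q 1) by lia.
        replace (angle 1 n + 2 * PI - angle q h / 2)
          with ((angle 1 n - angle q h / 2) + 2 * PI) by ring.
        rewrite sin_plus, cos_2PI, sin_2PI; ring.
      + unfold f; f_equal; unfold angle; field; lra. }
  rewrite s in e.
  replace (- sin (angle q h / 2) + sin (angle q h / 2)) with 0 in e by ring.
  apply Rmult_integral in e; destruct e as [e|e].
  (* A zero of the factor [sin (angle q h / 2)] would force [q | h], impossible for
     [0 < |h| < q]. *)
  + exfalso; assert (e' : sin (angle q h / 2) = 0) by lra.
    apply sin_eq_0_0 in e'; destruct e' as [k ek].
    assert (pi0 := PI_RGT_0).
    assert (IZR h = IZR (k * q)).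
    { rewrite mult_IZR; apply (Rmult_eq_reg_l PI); [|lra].
      unfold angle in ek; transitivity (IZR q * (2 * PI * IZR h / IZR q / 2)).
      - field; lra.
      - rewrite ek; ring. }
    apply eq_IZR in H; subst h.
    assert (k = 0)%Z by nia; lia.
  + rewrite <- e; apply rsum_ext; intros i _; f_equal.
    unfold angle; rewrite mult_IZR, <- INR_IZR_INZ; field; lra.
Qed.

Lemma rsum_single (f : nat -> R) (i n : nat) :
  (i < n)%nat -> (forall j, (j < n)%nat -> j <> i -> f j = 0) -> rsum f n = f i.
Proof.
intros hi h; induction n as [|n IH]; [lia|simpl].
destruct (Nat.eq_dec i n) as [->|ne].
- rewrite rsum_0; [ring|]; intros j hj; apply h; lia.
- rewrite IH, (h n) by (try intros; try apply h; lia); ring.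
Qed.

(** The left side sums the squared moduli of an exponential polynomial. Its frequencies
    [b, ..., b + h - 1] are distinct modulo [q] because [h <= q], so only the diagonal survives. *)
Lemma parseval (q : Z) (b h : nat) (w : nat -> R) :
  (0 < q)%Z -> (h <= Z.to_nat q)%nat ->
  rsum (fun a =>
    rsum (fun x => w x * cos (angle q (Z.of_nat a * Z.of_nat (b + x)))) h ^ 2
    + rsum (fun x => w x * sin (angle q (Z.of_nat a * Z.of_nat (b + x)))) h ^ 2)
    (Z.to_nat q)
  = IZR q * rsum (fun x => w x ^ 2) h.
Proof.
intros q0 hq.
rewrite (rsum_ext _ (fun a => rsum (fun x => rsum (fun y =>
  w x * w y * cos (angle q (Z.of_nat a * (Z.of_nat x - Z.of_nat y)))) h) h)).
2:{ intros a _; rewrite <- !Rsqr_pow2; unfold Rsqr.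
    rewrite !rsum_mul, <- rsum_plus; apply rsum_ext; intros x _.
    rewrite <- rsum_plus; apply rsum_ext; intros y _.
    replace (Z.of_nat a * (Z.of_nat x - Z.of_nat y))%Z
      with (Z.of_nat a * Z.of_nat (b + x) - Z.of_nat a * Z.of_nat (b + y))%Z by lia.
    rewrite angle_minus, cos_minus; ring. }
rewrite rsum_exchange, <- rsum_scal; apply rsum_ext; intros x hx.
rewrite rsum_exchange.
rewrite (rsum_ext _ (fun y => w x * w y *
  if Z.eq_dec (Z.of_nat x - Z.of_nat y) 0 then IZR q else 0)).
2:{ intros y hy; rewrite <- cos_orthogonality by lia; apply rsum_scal. }
rewrite (rsum_single _ x) by
  (first [assumption | intros j _ ne; destruct (Z.eq_dec _ _); [lia|ring]]).
destruct (Z.eq_dec _ _); [ring|lia].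
Qed.

Section gauss_sums.

Variables (q : Z) (r : Z -> R).
Hypothesis pq : primitive_quadratic q r.

Let N := Z.to_nat q.

Let q_pos : (0 < q)%Z.
Proof. pose proof (pq_gt1 _ _ pq); lia. Qed.

(** Taking [phi] to be the cosine or the sine of [angle q] gives the real and imaginary parts of the
    Gauss sum, which keeps the argument in [R]. *)
Definition gauss (phi : Z -> R) (m : Z) : R :=
  rsum (fun a => r (Z.of_nat a) * phi (m * Z.of_nat a)%Z) N.

(** Substituting [a -> u a] gives [gauss phi k = r u * gauss phi (u k)]. For a unit [m] take [u = m]
    and [k = 1]; for a non-unit take [u] fixing [m] modulo [q] with [r u = -1], and the sum
    vanishes. *)
Lemma gauss_separable (phi : Z -> R) (m : Z) :
  (forall n, phi (n + q)%Z = phi n) -> gauss phi m = r m * gauss phi 1.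
Proof.
intros per.
assert (mulper : forall k n, phi (k * (n + q))%Z = phi (k * n)%Z).
{ intros k n; apply (periodic_eq q); auto; exists k; ring. }
assert (unit : forall u k, Z.gcd u q = 1%Z -> gauss phi k = r u * gauss phi (u * k)).
{ intros u k g; unfold gauss, N.
  rewrite <- (rsum_unit q q_pos (fun a => r a * phi (k * a)%Z) u); auto.
  - rewrite <- rsum_scal; apply rsum_ext; intros i _.
    rewrite (pq_mul _ _ pq).
    replace (k * (u * Z.of_nat i))%Z with (u * k * Z.of_nat i)%Z by ring; ring.
  - intros n; rewrite mulper, (pq_periodic _ _ pq); auto. }
destruct (Z.eq_dec (Z.gcd m q) 1) as [g|g].
- rewrite (unit m 1%Z), Z.mul_1_r by auto.
  pose proof (pq_unit _ _ pq m g).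
  replace (r m * (r m * gauss phi m)) with (r m ^ 2 * gauss phi m) by ring; rewrite H; ring.
- rewrite (pq_zero _ _ pq m g).
  destruct (pq_separates _ _ pq m g) as [u [gu [d e]]].
  assert (gauss phi (u * m) = gauss phi m).
  { apply rsum_ext; intros i _; f_equal; apply (periodic_eq q); auto.
    destruct d as [k hk]; exists (k * Z.of_nat i)%Z; nia. }
  pose proof (unit u m gu); rewrite H, e in H0; lra.
Qed.

Lemma r_periodic (n : nat) : r (Z.of_nat (N + n)) = r (Z.of_nat n).
Proof.
apply (periodic_eq q); [apply (pq_periodic _ _ pq)|exists 1%Z; unfold N; lia].
Qed.

Lemma period_sum_0 (b : nat) : rsum (fun y => r (Z.of_nat (b + y))) N = 0.
Proof.
assert (z : rsum (fun y => r (Z.of_nat y)) N = 0).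
(* The plain character sum is the Gauss sum at the non-unit 0 for a constant [phi]. *)
{ pose proof (gauss_separable (fun _ => 1) 0%Z (fun _ => eq_refl)) as e.
  rewrite (pq_zero _ _ pq), Rmult_0_l in e.
  - rewrite <- e; apply rsum_ext; intros; ring.
  - rewrite Z.gcd_0_l; pose proof (pq_gt1 _ _ pq); lia. }
pose proof (rsum_add (fun y => r (Z.of_nat y)) b N) as e1.
pose proof (rsum_add (fun y => r (Z.of_nat y)) N b) as e2.
rewrite Nat.add_comm, e2, z in e1.
assert (e3 : rsum (fun i => r (Z.of_nat (N + i))) b = rsum (fun y => r (Z.of_nat y)) b).
{ apply rsum_ext; intros i _; apply r_periodic. }
rewrite e3 in e1; lra.
Qed.

Let C1 := gauss (fun k => cos (angle q k)) 1.
Let S1 := gauss (fun k => sin (angle q k)) 1.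

(** Sum the squared modulus of the Gauss sum at [a] over all [a]: separability gives the squared
    modulus at 1 times [sum r^2], Parseval gives [q] times the same positive sum. *)
Lemma gauss_modulus : C1 ^ 2 + S1 ^ 2 = IZR q.
Proof.
set (z := rsum (fun x => r (Z.of_nat x) ^ 2) N).
assert (z0 : 0 < z).
{ apply (rsum_pos _ 1); [pose proof (pq_gt1 _ _ pq); unfold N; lia|intros; apply pow2_ge_0|].
  change (0 < r 1%Z ^ 2); rewrite (pq_one _ _ pq); lra. }
apply (Rmult_eq_reg_r z); [|lra].
unfold z at 2; rewrite <- (parseval q 0 N (fun x => r (Z.of_nat x))) by (auto; unfold N; lia).
unfold z; rewrite <- rsum_scal; apply rsum_ext; intros a _.
pose proof (gauss_separable (fun k => cos (angle q k)) (Z.of_nat a)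
  (fun n => cos_angle_periodic q n q_pos)) as ec.
pose proof (gauss_separable (fun k => sin (angle q k)) (Z.of_nat a)
  (fun n => sin_angle_periodic q n q_pos)) as es.
fold C1 in ec; fold S1 in es.
change ((C1 ^ 2 + S1 ^ 2) * r (Z.of_nat a) ^ 2
  = gauss (fun k => cos (angle q k)) (Z.of_nat a) ^ 2
    + gauss (fun k => sin (angle q k)) (Z.of_nat a) ^ 2).
rewrite ec, es; ring.
Qed.

(** Separability expands [r (b + y + x)] into exponentials, which factor into a part [V a] depending
    on [y] and a part [U a] depending on [x]. Parseval gives the square sums [q H] and [q t];
    Cauchy-Schwarz and division by the modulus [sqrt q] finish. *)
Lemma bilinear_short (b H t : nat) :
  (H <= N)%nat -> (t <= N)%nat ->
  Rabs (rsum (fun y => rsum (fun x => r (Z.of_nat (b + y + x))) H) t)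
  <= sqrt (IZR q * INR H * INR t).
Proof.
intros hH ht.
set (X := rsum _ t).
assert (Rq : 0 < IZR q) by (apply IZR_lt; auto).
pose (ca := fun a x => cos (angle q (Z.of_nat a * Z.of_nat x))).
pose (sa := fun a x => sin (angle q (Z.of_nat a * Z.of_nat x))).
pose (Uc := fun a => rsum (fun x => 1 * ca a (0 + x)%nat) H).
pose (Us := fun a => rsum (fun x => 1 * sa a (0 + x)%nat) H).
pose (Vc := fun a => rsum (fun y => 1 * ca a (b + y)%nat) t).
pose (Vs := fun a => rsum (fun y => 1 * sa a (b + y)%nat) t).
pose proof (parseval q 0 H (fun _ => 1) q_pos hH) as pU.
pose proof (parseval q b t (fun _ => 1) q_pos ht) as pV.
fold N in pU, pV.
rewrite (rsum_ext (fun _ => 1 ^ 2) (fun _ => 1)), rsum_const in pU, pV by (intros; ring).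
change (rsum (fun a => Uc a ^ 2 + Us a ^ 2) N = IZR q * (INR H * 1)) in pU.
change (rsum (fun a => Vc a ^ 2 + Vs a ^ 2) N = IZR q * (INR t * 1)) in pV.
assert (ec : C1 * X = rsum (fun a => r (Z.of_nat a) * (Vc a * Uc a - Vs a * Us a)) N).
{ rewrite (rsum_ext (fun a => r (Z.of_nat a) * (Vc a * Uc a - Vs a * Us a))
    (fun a => rsum (fun y => rsum (fun x =>
       r (Z.of_nat a) * cos (angle q (Z.of_nat (b + y + x) * Z.of_nat a))) H) t)).
  - rewrite rsum_exchange; unfold X; rewrite <- rsum_scal; apply rsum_ext; intros y _.
    rewrite rsum_exchange, <- rsum_scal; apply rsum_ext; intros x _.
    unfold C1; rewrite Rmult_comm, <- gauss_separable; auto.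
    intros n; apply cos_angle_periodic, q_pos.
  - intros a _; unfold Vc, Vs, Uc, Us.
    rewrite !rsum_mul, <- rsum_minus, <- rsum_scal; apply rsum_ext; intros y _.
    rewrite <- rsum_minus, <- rsum_scal; apply rsum_ext; intros x _; unfold ca, sa.
    replace (Z.of_nat (b + y + x) * Z.of_nat a)%Z
      with (Z.of_nat a * Z.of_nat (b + y) + Z.of_nat a * Z.of_nat (0 + x))%Z by lia.
    rewrite angle_plus, cos_plus; ring. }
assert (es : S1 * X = rsum (fun a => r (Z.of_nat a) * (Vs a * Uc a + Vc a * Us a)) N).
{ rewrite (rsum_ext (fun a => r (Z.of_nat a) * (Vs a * Uc a + Vc a * Us a))
    (fun a => rsum (fun y => rsum (fun x =>
       r (Z.of_nat a) * sin (angle q (Z.of_nat (b + y + x) * Z.of_nat a))) H) t)).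
  - rewrite rsum_exchange; unfold X; rewrite <- rsum_scal; apply rsum_ext; intros y _.
    rewrite rsum_exchange, <- rsum_scal; apply rsum_ext; intros x _.
    unfold S1; rewrite Rmult_comm, <- gauss_separable; auto.
    intros n; apply sin_angle_periodic, q_pos.
  - intros a _; unfold Vc, Vs, Uc, Us.
    rewrite !rsum_mul, <- rsum_plus, <- rsum_scal; apply rsum_ext; intros y _.
    rewrite <- rsum_plus, <- rsum_scal; apply rsum_ext; intros x _; unfold ca, sa.
    replace (Z.of_nat (b + y + x) * Z.of_nat a)%Z
      with (Z.of_nat a * Z.of_nat (b + y) + Z.of_nat a * Z.of_nat (0 + x))%Z by lia.
    rewrite angle_plus, sin_plus; ring. }
pose (U := fun a => Uc a ^ 2 + Us a ^ 2).
pose (V := fun a => Vc a ^ 2 + Vs a ^ 2).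
assert (U0 : forall a, 0 <= U a) by (intros; unfold U; nra).
assert (V0 : forall a, 0 <= V a) by (intros; unfold V; nra).
assert (r1 : forall n, r n ^ 2 <= 1).
{ intros n; destruct (Z.eq_dec (Z.gcd n q) 1) as [g|g].
  - rewrite (pq_unit _ _ pq n g); lra.
  - rewrite (pq_zero _ _ pq n g); lra. }
(* [IZR q * X] is [C1 * (C1 * X) + S1 * (S1 * X)]. In each term [k] and [l] are the real and
   imaginary parts of a product of two complex numbers, so [k ^ 2 + l ^ 2 = U a * V a]. *)
assert (bd : IZR q * Rabs X <= sqrt (IZR q) * rsum (fun a => sqrt (U a) * sqrt (V a)) N).
{ rewrite <- (Rabs_pos_eq (IZR q)) at 1 by lra.
  rewrite <- Rabs_mult, <- gauss_modulus.
  replace ((C1 ^ 2 + S1 ^ 2) * X) with (C1 * (C1 * X) + S1 * (S1 * X)) by ring.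
  rewrite ec, es, <- !rsum_scal, <- rsum_plus.
  eapply Rle_trans; [apply rsum_abs|].
  apply rsum_le; intros a _.
  rewrite <- !sqrt_mult by (auto using Rmult_le_pos, Rplus_le_le_0_compat, pow2_ge_0).
  rewrite <- sqrt_Rsqr_abs; apply sqrt_le_1_alt; unfold Rsqr.
  set (k := Vc a * Uc a - Vs a * Us a); set (l := Vs a * Uc a + Vc a * Us a).
  assert (e : U a * V a = k ^ 2 + l ^ 2) by (unfold U, V, k, l; ring).
  rewrite e.
  replace (_ * _) with (r (Z.of_nat a) ^ 2 * (C1 * k + S1 * l) ^ 2) by ring.
  apply Rle_trans with (1 * (C1 * k + S1 * l) ^ 2).
  - apply Rmult_le_compat_r; auto; apply pow2_ge_0.
  - pose proof (pow2_ge_0 (C1 * l - S1 * k)); nra. }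
pose proof (rsum_cauchy_schwarz (fun a => sqrt (U a)) (fun a => sqrt (V a)) N) as cs.
rewrite (rsum_ext (fun i => sqrt (U i) ^ 2) U), (rsum_ext (fun i => sqrt (V i) ^ 2) V) in cs
  by (intros; apply pow2_sqrt; auto).
unfold U at 2, V at 2 in cs; rewrite pU, pV in cs.
set (w := rsum (fun a => sqrt (U a) * sqrt (V a)) N) in *.
apply Rsqr_incr_0_var; [|apply sqrt_pos].
pose proof (pos_INR H); pose proof (pos_INR t).
rewrite Rsqr_sqrt by (apply Rmult_le_pos; auto; apply Rmult_le_pos; lra).
assert (p : (IZR q * Rabs X) ^ 2 <= (sqrt (IZR q) * w) ^ 2).
{ apply pow_incr; split; auto; apply Rmult_le_pos; [lra|apply Rabs_pos]. }
rewrite !Rpow_mult_distr, pow2_sqrt in p by lra.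
unfold Rsqr.
apply (Rmult_le_reg_l (IZR q ^ 2)); [nra|].
assert (IZR q * w ^ 2 <= IZR q * (IZR q * (INR H * 1) * (IZR q * (INR t * 1))))
  by (apply Rmult_le_compat_l; lra).
replace (IZR q ^ 2 * (Rabs X * Rabs X)) with (IZR q ^ 2 * Rabs X ^ 2) by ring; nra.
Qed.

(** A full period in [y] contributes 0, so [t] may be reduced modulo [q] and Parseval applies to
    arbitrarily long ranges. *)
Lemma bilinear (b H t : nat) :
  (H <= N)%nat ->
  Rabs (rsum (fun y => rsum (fun x => r (Z.of_nat (b + y + x))) H) t)
  <= sqrt (IZR q * INR H * INR t).
Proof.
intros hH.
assert (N0 : N <> 0%nat) by (unfold N; lia).
assert (Rq : 0 < IZR q) by (apply IZR_lt; auto).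
pose (f := fun y => rsum (fun x => r (Z.of_nat (b + y + x))) H).
change (Rabs (rsum f t) <= sqrt (IZR q * INR H * INR t)).
rewrite (rsum_mod f N) by (auto; first
  [ intros i; apply rsum_ext; intros x _; rewrite <- (r_periodic (b + i + x)); do 2 f_equal; lia
  | unfold f; rewrite rsum_exchange; apply rsum_0; intros x _;
    rewrite <- (period_sum_0 (b + x)); apply rsum_ext; intros y _; do 2 f_equal; lia ]).
eapply Rle_trans.
- apply bilinear_short; auto; apply Nat.lt_le_incl, Nat.mod_upper_bound; auto.
- apply sqrt_le_1_alt, Rmult_le_compat_l; [|apply le_INR, Nat.Div0.mod_le].
  apply Rmult_le_pos; [lra|apply pos_INR].
Qed.

Lemma pq_bound (n : Z) : Rabs (r n) <= 1.
Proof.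
destruct (Z.eq_dec (Z.gcd n q) 1) as [g|g].
- pose proof (pq_unit _ _ pq n g); apply Rabs_le; nra.
- rewrite (pq_zero _ _ pq n g), Rabs_R0; lra.
Qed.

(** Crude, but it serves only the convergence of the series. *)
Lemma character_sum_bound (b t : nat) :
  Rabs (rsum (fun i => r (Z.of_nat (b + i))) t) <= IZR q.
Proof.
assert (N0 : N <> 0%nat) by (unfold N; lia).
rewrite (rsum_mod _ N) by (auto; first
  [ apply period_sum_0
  | intros i; rewrite <- (r_periodic (b + i)); do 2 f_equal; lia ]).
eapply Rle_trans; [apply rsum_abs|].
eapply Rle_trans; [apply (rsum_le _ (fun _ => 1)); intros; apply pq_bound|].
rewrite rsum_const, Rmult_1_r, <- (Z2Nat.id q), <- INR_IZR_INZ by lia.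
apply le_INR, Nat.lt_le_incl, Nat.mod_upper_bound; auto.
Qed.

End gauss_sums.

(** * Smoothed partial summation *)

Lemma rsum_telescope (F : nat -> R) (n : nat) :
  rsum (fun i => F i - F (S i)) n = F 0%nat - F n.
Proof. induction n as [|n IH]; simpl; [|rewrite IH]; ring. Qed.

Lemma abel_summation (d G : nat -> R) (n : nat) :
  rsum (fun i => d i * G i) n
  = rsum (fun i => (G i - G (S i)) * rsum d (S i)) n + G n * rsum d n.
Proof. induction n as [|n IH]; simpl in *; [|rewrite IH]; ring. Qed.

Lemma abel_bound (d G b : nat -> R) (n : nat) :
  (forall i, 0 <= G i) -> (forall i, G (S i) <= G i) ->
  (forall t, Rabs (rsum d t) <= b t) ->
  Rabs (rsum (fun i => d i * G i) n)
  <= rsum (fun i => (G i - G (S i)) * b (S i)) n + G n * b n.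
Proof.
intros G0 dec hb; rewrite abel_summation.
eapply Rle_trans; [apply Rabs_triang|]; apply Rplus_le_compat.
- eapply Rle_trans; [apply rsum_abs|]; apply rsum_le; intros i _.
  specialize (dec i); rewrite Rabs_mult, Rabs_pos_eq by lra.
  apply Rmult_le_compat_l; [lra|auto].
- rewrite Rabs_mult, Rabs_pos_eq by auto; apply Rmult_le_compat_l; auto.
Qed.

Lemma abel_bound_const (d G : nat -> R) (B : R) (n : nat) :
  (forall i, 0 <= G i) -> (forall i, G (S i) <= G i) ->
  (forall t, Rabs (rsum d t) <= B) ->
  Rabs (rsum (fun i => d i * G i) n) <= B * G 0%nat.
Proof.
intros G0 dec hb.
eapply Rle_trans; [apply (abel_bound d G (fun _ => B)); auto|].
rewrite (rsum_ext _ (fun i => B * (G i - G (S i)))) by (intros; ring).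
rewrite rsum_scal, rsum_telescope; lra.
Qed.

(** One more shift changes the coefficients by a telescoping sequence, whose partial sums are at
    most 2. *)
Lemma shift_bound (r G : nat -> R) (h n : nat) :
  (forall i, Rabs (r i) <= 1) ->
  (forall i, 0 <= G i) -> (forall i, G (S i) <= G i) ->
  Rabs (rsum (fun i => r i * G i) n - rsum (fun i => r (h + i)%nat * G i) n)
  <= 2 * INR h * G 0%nat.
Proof.
intros hr G0 dec; induction h as [|h IH].
- simpl; rewrite Rminus_diag, Rabs_R0; lra.
- assert (step : Rabs (rsum (fun i => (r (h + i)%nat - r (h + S i)%nat) * G i) n)
                 <= 2 * G 0%nat).
  { apply abel_bound_const; auto; intros t.
    rewrite (rsum_telescope (fun i => r (h + i)%nat)).
    eapply Rle_trans; [apply Rabs_triang|]; rewrite Rabs_Ropp.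
    pose proof (hr (h + 0)%nat); pose proof (hr (h + t)%nat); lra. }
  rewrite S_INR.
  replace (rsum (fun i => r i * G i) n - rsum (fun i => r (S h + i)%nat * G i) n)
    with ((rsum (fun i => r i * G i) n - rsum (fun i => r (h + i)%nat * G i) n)
          + rsum (fun i => (r (h + i)%nat - r (h + S i)%nat) * G i) n).
  + eapply Rle_trans; [apply Rabs_triang|]; lra.
  + rewrite (rsum_ext (fun i => (_ - _) * _)
      (fun i => r (h + i)%nat * G i - r (S h + i)%nat * G i)), rsum_minus.
    * ring.
    * intros i _; rewrite Nat.add_succ_r; simpl; ring.
Qed.

(* Averaging over [H] shifts costs [H * G 0] and replaces the sums of [r] by
   sums over windows, which are the ones that [bilinear] controls. *)
Lemma smoothed_bound (r G b : nat -> R) (H n : nat) :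
  (0 < H)%nat -> (forall i, Rabs (r i) <= 1) ->
  (forall i, 0 <= G i) -> (forall i, G (S i) <= G i) ->
  (forall t, Rabs (rsum (fun y => rsum (fun x => r (y + x)%nat) H) t) <= b t) ->
  Rabs (rsum (fun i => r i * G i) n)
  <= INR H * G 0%nat
     + / INR H * (rsum (fun i => (G i - G (S i)) * b (S i)) n + G n * b n).
Proof.
intros H0 hr G0 dec hb.
apply lt_INR in H0; simpl in H0.
set (X := rsum (fun i => r i * G i) n).
pose (Y := fun h => rsum (fun i => r (h + i)%nat * G i) n).
pose proof (abel_bound _ _ b n G0 dec hb) as ab; cbv beta in ab.
set (E := rsum (fun i => (G i - G (S i)) * b (S i)) n + G n * b n) in *.
assert (sw : rsum Y H = rsum (fun y => rsum (fun x => r (y + x)%nat) H * G y) n).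
{ unfold Y; rewrite rsum_exchange; apply rsum_ext; intros i _.
  rewrite Rmult_comm, <- rsum_scal; apply rsum_ext; intros x _.
  rewrite Nat.add_comm; ring. }
rewrite <- sw in ab.
assert (df : Rabs (rsum (fun h => X - Y h) H) <= INR H * INR H * G 0%nat).
{ eapply Rle_trans; [apply rsum_abs|].
  eapply Rle_trans; [apply (rsum_le _ (fun h => G 0%nat * (2 * INR h)))|].
  - intros h _; unfold X, Y.
    pose proof (shift_bound r G h n hr G0 dec); lra.
  - rewrite rsum_scal.
    (* A shift [h < H] is about [H / 2] on average, which absorbs the factor 2 of [shift_bound]. *)
    assert (tri : forall m, rsum (fun h => 2 * INR h) m <= INR m * INR m).
    { induction m as [|m IH]; simpl rsum; [simpl; lra|].
      rewrite S_INR; pose proof (pos_INR m); nra. }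
    specialize (tri H); specialize (G0 0%nat); nra. }
rewrite rsum_minus, rsum_const in df.
apply (Rmult_le_reg_l (INR H)); auto.
rewrite <- (Rabs_pos_eq (INR H)) at 1 by lra; rewrite <- Rabs_mult.
replace (INR H * (INR H * G 0%nat + / INR H * E)) with (INR H * INR H * G 0%nat + E)
  by (field; lra).
replace (INR H * X) with ((INR H * X - rsum Y H) + rsum Y H) by ring.
eapply Rle_trans; [apply Rabs_triang|]; lra.
Qed.

Lemma decreasing_of_derive (f df : R -> R) (a b : R) :
  a <= b -> (forall x, a <= x <= b -> is_derive f x (df x)) ->
  (forall x, a <= x <= b -> df x <= 0) -> f b <= f a.
Proof.
intros ab hd neg.
destruct (MVT_gen f a b df) as [z [hz e]].
- intros x hx; rewrite Rmin_left, Rmax_right in hx by auto; apply hd; lra.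
- intros x hx; rewrite Rmin_left, Rmax_right in hx by auto.
  apply derivable_continuous_pt; exists (df x); apply is_derive_Reals, hd; lra.
- rewrite Rmin_left, Rmax_right in hz by auto.
  pose proof (neg z hz); nra.
Qed.

(** * Monotonicity and tails of the weights *)

Definition weight (x c t : R) : R := Rpower t (- x) * (ln t - c).

Definition weight_tail (x c t : R) : R :=
  Rpower t (1 / 2 - x) * ((ln t - c) * (1 + / (2 * x - 1)) + 2 / (2 * x - 1) ^ 2).

Section weight_bounds.

Variables x c : R.
Hypothesis hx : 1 / 2 < x.

(** In the variable [s = ln t] the derivative is [exp (- x s) (1 - x (s - c))]; the second
    hypothesis puts [u] beyond the maximum. *)
Lemma weight_decreasing (u v : R) :
  0 < u <= v -> 1 <= x * (ln u - c) -> weight x c v <= weight x c u.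
Proof.
intros [u0 uv] h; unfold weight, Rpower.
assert (l : ln u <= ln v) by (apply ln_le; lra).
apply (decreasing_of_derive (fun s => exp (- x * s) * (s - c))
  (fun s => exp (- x * s) * (1 - x * (s - c)))); auto.
- intros s _; auto_derive; auto; ring.
- intros s hs; pose proof (exp_pos (- x * s)).
  assert (x * (ln u - c) <= x * (s - c)) by (apply Rmult_le_compat_l; lra); nra.
Qed.

(* [weight_tail] is the antiderivative of [sqrt t * weight' t] vanishing at infinity. *)
Lemma weight_tail_step (u v : R) :
  0 < u <= v -> 1 <= x * (ln u - c) ->
  (weight x c u - weight x c v) * sqrt u <= weight_tail x c u - weight_tail x c v.
Proof.
intros [u0 uv] h; unfold weight, weight_tail.
rewrite <- Rpower_sqrt by auto; unfold Rpower.
assert (l : ln u <= ln v) by (apply ln_le; lra).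
(* With [k = sqrt u] frozen, the difference [weight_tail - k * weight] has derivative [(sqrt t - k)]
   times that of the weight, which is nonpositive on [[u, v]]. *)
set (k := exp (/ 2 * ln u)).
pose proof (decreasing_of_derive (fun s =>
    exp ((1 / 2 - x) * s) * ((s - c) * (1 + / (2 * x - 1)) + 2 / (2 * x - 1) ^ 2)
    - k * (exp (- x * s) * (s - c)))
  (fun s => (exp (/ 2 * s) - k) * (exp (- x * s) * (1 - x * (s - c)))) (ln u) (ln v) l) as D.
cbv beta in D.
assert (exp ((1 / 2 - x) * ln v) * ((ln v - c) * (1 + / (2 * x - 1)) + 2 / (2 * x - 1) ^ 2)
    - k * (exp (- x * ln v) * (ln v - c))
  <= exp ((1 / 2 - x) * ln u) * ((ln u - c) * (1 + / (2 * x - 1)) + 2 / (2 * x - 1) ^ 2)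
    - k * (exp (- x * ln u) * (ln u - c))); [|lra].
apply D.
- intros s _; auto_derive; auto.
  replace ((1 / 2 - x) * s) with (/ 2 * s + - x * s) by field.
  rewrite exp_plus; field; lra.
- intros s hs; pose proof (exp_pos (- x * s)).
  assert (x * (ln u - c) <= x * (s - c)) by (apply Rmult_le_compat_l; lra).
  assert (k <= exp (/ 2 * s)).
  { unfold k; destruct (Req_dec (ln u) s) as [->|ne]; [lra|].
    apply Rlt_le, exp_increasing; lra. }
  assert (exp (- x * s) * (1 - x * (s - c)) <= 0) by nra; nra.
Qed.

(** Controls the boundary term of the partial summation: the left side is one of the nonnegative
    summands of [weight_tail]. *)
Lemma weight_le_tail (t : R) :
  0 < t -> 0 <= ln t - c -> weight x c t * sqrt t <= weight_tail x c t.
Proof.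
intros t0 h; unfold weight, weight_tail.
replace (Rpower t (1 / 2 - x)) with (Rpower t (- x) * sqrt t).
- assert (0 <= Rpower t (- x) * sqrt t).
  { apply Rmult_le_pos; [apply Rlt_le, exp_pos|apply sqrt_pos]. }
  assert (0 < / (2 * x - 1)) by (apply Rinv_0_lt_compat; lra).
  assert (0 < 2 / (2 * x - 1) ^ 2) by (apply Rdiv_lt_0_compat; nra).
  rewrite Rmult_assoc, (Rmult_comm (ln t - c)), <- Rmult_assoc.
  apply Rmult_le_compat_l; auto; nra.
- rewrite <- Rpower_sqrt, <- Rpower_plus by auto; f_equal; field.
Qed.

End weight_bounds.

Lemma character_tail (q : Z) (r : Z -> R) (x c : R) (M H n : nat) :
  primitive_quadratic q r -> 1 / 2 < x -> (0 < H <= Z.to_nat q)%nat -> (0 < M)%nat ->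
  1 <= x * (ln (INR M) - c) ->
  Rabs (rsum (fun i => r (Z.of_nat (M + i)) * weight x c (INR (M + i))) n)
  <= INR H * weight x c (INR M) + sqrt (IZR q / INR H) * weight_tail x c (INR M).
Proof.
intros pq hx [H0 HN] M0 hM.
assert (Mi : forall i, 0 < INR M <= INR (M + i)).
{ intros i; split; [apply (lt_INR 0); auto|apply le_INR; lia]. }
assert (big : forall i, 1 <= x * (ln (INR (M + i)) - c)).
{ intros i; destruct (Mi i); assert (ln (INR M) <= ln (INR (M + i))) by (apply ln_le; auto).
  nra. }
assert (pos : forall i, 0 <= ln (INR (M + i)) - c).
{ intros i; specialize (big i); nra. }
assert (RH : 0 < INR H) by (apply (lt_INR 0); auto).
assert (Rq : 0 < IZR q) by (apply IZR_lt; pose proof (pq_gt1 _ _ pq); lia).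
pose (G := fun i => weight x c (INR (M + i))).
assert (dec : forall i, G (S i) <= G i).
{ intros i; apply weight_decreasing; auto.
  destruct (Mi i); split; [lra|apply le_INR; lia]. }
assert (G0 : forall i, 0 <= G i).
{ intros i; apply Rmult_le_pos; auto; apply Rlt_le, exp_pos. }
pose (K := sqrt (IZR q * INR H)).
eapply Rle_trans.
{ apply (smoothed_bound (fun i => r (Z.of_nat (M + i))) G (fun t => K * sqrt (INR t)) H); auto.
  - intros i; apply (pq_bound _ _ pq).
  - intros t; unfold K; rewrite <- sqrt_mult by (try apply pos_INR; nra).
    eapply Rle_trans; [|apply (bilinear q r pq M H t HN)].
    apply Req_le; f_equal; apply rsum_ext; intros y _; apply rsum_ext; intros z _.
    do 2 f_equal; lia. }
unfold G at 1; rewrite Nat.add_0_r; apply Rplus_le_compat_l.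
pose (F := fun i => weight_tail x c (INR (M + i))).
(* Since [i + 1 <= M + i], the factor [sqrt (i + 1)] fits [weight_tail_step]; the sum telescopes and
   the boundary term is absorbed by [F n]. *)
assert (tail : rsum (fun i => (G i - G (S i)) * (K * sqrt (INR (S i)))) n
               + G n * (K * sqrt (INR n)) <= K * F 0%nat).
{ replace (F 0%nat) with ((F 0%nat - F n) + F n) by ring.
  rewrite Rmult_plus_distr_l; apply Rplus_le_compat.
  - rewrite <- (rsum_telescope F), <- rsum_scal; apply rsum_le; intros i _.
    replace (_ * _) with (K * ((G i - G (S i)) * sqrt (INR (S i)))) by ring.
    apply Rmult_le_compat_l; [apply sqrt_pos|].
    eapply Rle_trans; [|apply weight_tail_step; auto].
    + apply Rmult_le_compat_l; [specialize (dec i); unfold G in *; lra|].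
      apply sqrt_le_1_alt, le_INR; lia.
    + destruct (Mi i); split; [lra|apply le_INR; lia].
  - replace (_ * _) with (K * (G n * sqrt (INR n))) by ring.
    apply Rmult_le_compat_l; [apply sqrt_pos|].
    eapply Rle_trans; [|apply weight_le_tail; auto; destruct (Mi n); lra].
    apply Rmult_le_compat_l; [apply G0|]; apply sqrt_le_1_alt, le_INR; lia. }
replace (weight_tail x c (INR M)) with (F 0%nat) by (unfold F; rewrite Nat.add_0_r; auto).
replace (sqrt (IZR q / INR H)) with (/ INR H * K).
- rewrite Rmult_assoc; apply Rmult_le_compat_l; auto; apply Rlt_le, Rinv_0_lt_compat; auto.
- unfold K; rewrite <- (sqrt_Rsqr (INR H)) at 1 by lra.
  rewrite <- sqrt_inv, <- sqrt_mult.
  + f_equal; unfold Rsqr; field; lra.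
  + apply Rlt_le, Rinv_0_lt_compat, Rlt_0_sqr; lra.
  + nra.
Qed.

(** * Logarithmic sums *)

(** Truncated series of [2 artanh z]: the derivative of the difference is [- 2 t^6 / (1 - t^2)]. The
    upper bound below compares the remainder with a geometric series. *)
Lemma ln_ratio_lower (z : R) :
  0 <= z < 1 -> 2 * z + 2 * z ^ 3 / 3 + 2 * z ^ 5 / 5 <= ln ((1 + z) / (1 - z)).
Proof.
intros [z0 z1].
rewrite ln_div by lra.
pose proof (decreasing_of_derive
  (fun t => 2 * t + 2 * t ^ 3 / 3 + 2 * t ^ 5 / 5 - (ln (1 + t) - ln (1 - t)))
  (fun t => 2 + 2 * t ^ 2 + 2 * t ^ 4 - 2 / (1 - t ^ 2)) 0 z z0) as D.
cbv beta in D.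
rewrite Rplus_0_r, Rminus_0_r, ln_1 in D.
assert (2 * z + 2 * z ^ 3 / 3 + 2 * z ^ 5 / 5 - (ln (1 + z) - ln (1 - z))
  <= 2 * 0 + 2 * 0 ^ 3 / 3 + 2 * 0 ^ 5 / 5 - (0 - 0)); [|lra].
apply D; intros t ht.
- auto_derive; [lra|]; field; nra.
- assert (0 < 1 - t ^ 2) by nra.
  apply (Rmult_le_reg_r (1 - t ^ 2)); auto.
  rewrite Rmult_0_l; unfold Rminus at 1; rewrite Rmult_plus_distr_r.
  replace (- (2 / (1 - t ^ 2)) * (1 - t ^ 2)) with (-2) by (field; lra).
  pose proof (pow2_ge_0 (t ^ 3)); nra.
Qed.

Lemma ln_ratio_upper (z : R) :
  0 <= z < 1 -> ln ((1 + z) / (1 - z)) <= 2 * z + 2 * z ^ 3 / (3 * (1 - z ^ 2)).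
Proof.
intros [z0 z1].
rewrite ln_div by lra.
pose proof (decreasing_of_derive
  (fun t => (ln (1 + t) - ln (1 - t)) - (2 * t + 2 * t ^ 3 / (3 * (1 - t ^ 2))))
  (fun t => - (4 / 3 * t ^ 4 / (1 - t ^ 2) ^ 2)) 0 z z0) as D.
cbv beta in D.
rewrite Rplus_0_r, Rminus_0_r, ln_1 in D.
assert ((ln (1 + z) - ln (1 - z)) - (2 * z + 2 * z ^ 3 / (3 * (1 - z ^ 2)))
  <= 0 - 0 - (2 * 0 + 2 * 0 ^ 3 / (3 * (1 - 0 ^ 2)))); [|lra].
apply D; intros t ht.
- assert (0 < 1 - t ^ 2) by nra.
  auto_derive; [repeat split; nra|]; field; repeat split; nra.
- assert (0 < 1 - t ^ 2) by nra.
  assert (0 <= 4 / 3 * t ^ 4 / (1 - t ^ 2) ^ 2); [|lra].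
  apply Rdiv_le_0_compat; [|nra].
  replace (t ^ 4) with ((t ^ 2) ^ 2) by ring; pose proof (pow2_ge_0 (t ^ 2)); lra.
Qed.

Definition signed_square (w : R) : R := / 2 * (w * Rabs w).

Lemma signed_square_le (v w : R) : v <= w -> signed_square v <= signed_square w.
Proof.
intros h; unfold signed_square.
destruct (Rcase_abs v), (Rcase_abs w);
  rewrite ?(Rabs_left v), ?(Rabs_right v), ?(Rabs_left w), ?(Rabs_right w) by auto; nra.
Qed.

(* Midpoint rule for [|ln t - c| / t], whose antiderivative is the signed
   square of [ln t - c]; the convex part needs no error term. *)
Lemma log_midpoint (c n : R) :
  2 <= n ->
  Rabs (ln n - c) / n
  <= signed_square (ln (n + / 2) - c) - signed_square (ln (n - / 2) - c)
     + / 16 * (/ (n - 1) ^ 2 - / n ^ 2).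
Proof.
intros hn.
set (a := ln (n + / 2)); set (b := ln (n - / 2)).
assert (p_lower : / n <= a - b).
{ pose proof (ln_ratio_lower (/ (2 * n))) as l.
  assert (0 < / (2 * n) < 1).
  { split; [apply Rinv_0_lt_compat; lra|].
    rewrite <- Rinv_1; apply Rinv_lt_contravar; lra. }
  replace ((1 + / (2 * n)) / (1 - / (2 * n))) with ((n + / 2) / (n - / 2)) in l
    by (field; repeat split; lra).
  rewrite ln_div in l by lra.
  assert (0 <= (/ (2 * n)) ^ 3) by (apply pow_le; lra).
  assert (0 <= (/ (2 * n)) ^ 5) by (apply pow_le; lra).
  replace (/ n) with (2 * / (2 * n)) by (field; lra).
  unfold a, b; lra. }
assert (ln_le_sub : forall t, 0 < t -> ln t <= t - 1).
{ intros t t0; pose proof (exp_ineq1_le (ln t)); rewrite exp_ln in H by auto; lra. }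
assert (p_upper : a - b <= / (n - / 2)).
{ unfold a, b; rewrite <- ln_div by lra.
  eapply Rle_trans; [apply ln_le_sub; apply Rdiv_lt_0_compat; lra|].
  apply Req_le; field; lra. }
assert (mid : a + b <= 2 * ln n).
{ unfold a, b; rewrite <- ln_mult by lra.
  replace (2 * ln n) with (ln n + ln n) by ring; rewrite <- ln_mult by lra.
  apply ln_le; nra. }
assert (mid' : 2 * ln n - (a + b) <= / ((2 * n - 1) * (2 * n + 1))).
{ unfold a, b; rewrite <- ln_mult by lra.
  replace (2 * ln n) with (ln n + ln n) by ring; rewrite <- ln_mult, <- ln_div by nra.
  eapply Rle_trans; [apply ln_le_sub; apply Rdiv_lt_0_compat; nra|].
  apply Req_le; field; repeat split; nra. }
assert (sq : forall v w, w <= v ->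
  Rabs (/ 2 * (v - w) * (v + w)) <= signed_square v - signed_square w).
{ intros v w h; unfold signed_square; apply Rabs_le.
  destruct (Rcase_abs v), (Rcase_abs w);
    rewrite ?(Rabs_left v), ?(Rabs_right v), ?(Rabs_left w), ?(Rabs_right w) by auto;
    split; nra. }
assert (p0 : 0 < / n) by (apply Rinv_0_lt_compat; lra).
pose proof (sq (a - c) (b - c)) as s.
replace (/ 2 * (a - c - (b - c)) * (a - c + (b - c)))
  with (/ 2 * (a - b) * (a + b - 2 * c)) in s by ring.
assert (s' := s ltac:(lra)); clear s.
set (V := signed_square (a - c) - signed_square (b - c)) in *.
(* The mean [(a + b) / 2] lies below [ln n], which helps when [ln n < c] and costs this amount
   otherwise. The cost is about [1 / (8 n^3)], and the right side is a telescoping majorant of the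
   same order. *)
assert (err : (a - b) * (/ 2 * (2 * ln n - (a + b))) <= / 16 * (/ (n - 1) ^ 2 - / n ^ 2)).
{ apply Rle_trans with (/ (n - / 2) * (/ 2 * / ((2 * n - 1) * (2 * n + 1)))).
  - apply Rmult_le_compat; lra.
  - replace (/ (n - / 2) * (/ 2 * / ((2 * n - 1) * (2 * n + 1))))
      with (/ ((2 * n - 1) ^ 2 * (2 * n + 1))) by (field; lra).
    replace (/ 16 * (/ (n - 1) ^ 2 - / n ^ 2))
      with (/ (16 * (n - 1) ^ 2 * n ^ 2 / (2 * n - 1))) by (field; lra).
    apply Rinv_le_contravar.
    + apply Rdiv_lt_0_compat; [|lra].
      apply Rmult_lt_0_compat; [|nra]; apply Rmult_lt_0_compat; nra.
    + apply (Rmult_le_reg_r (2 * n - 1)); [lra|].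
      replace (16 * (n - 1) ^ 2 * n ^ 2 / (2 * n - 1) * (2 * n - 1))
        with ((4 * (n - 1) * n) ^ 2) by (field; lra).
      replace ((2 * n - 1) ^ 2 * (2 * n + 1) * (2 * n - 1))
        with (((2 * n - 1) ^ 2) ^ 2 + 2 * (2 * n - 1) ^ 3) by ring.
      assert (0 <= (2 * n - 1) ^ 3) by (apply pow_le; lra).
      assert ((4 * (n - 1) * n) ^ 2 <= ((2 * n - 1) ^ 2) ^ 2); [|lra].
      apply pow_incr; nra. }
assert (err0 : 0 <= (a - b) * (/ 2 * (2 * ln n - (a + b)))) by nra.
unfold Rdiv; destruct (Rle_dec c (ln n)) as [h|h].
- rewrite Rabs_pos_eq by lra.
  apply Rle_trans with ((ln n - c) * (a - b)); [apply Rmult_le_compat_l; lra|].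
  pose proof (Rle_abs (/ 2 * (a - b) * (a + b - 2 * c))); nra.
- rewrite Rabs_left by lra.
  apply Rle_trans with (- (ln n - c) * (a - b)); [apply Rmult_le_compat_l; lra|].
  pose proof (Rle_abs (- (/ 2 * (a - b) * (a + b - 2 * c)))) as t.
  rewrite Rabs_Ropp in t; nra.
Qed.

(** The term [n = 1] is [c] itself. From [n = 2] on, the midpoint intervals start at [3 / 2], and
    the telescoping errors add up to at most [1 / 16]. *)
Lemma log_sum_bound (c : R) (M : nat) :
  (1 <= M)%nat -> ln (3 / 2) <= c -> c <= ln (INR (S M)) ->
  rsum (fun i => Rabs (ln (INR (S i)) - c) / INR (S i)) M
  <= c + / 2 * (ln (INR (S M)) - c) ^ 2 + / 2 * (c - ln (3 / 2)) ^ 2 + / 16.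
Proof.
intros hM hc hcM.
assert (c0 : 0 <= c).
{ assert (ln 1 <= ln (3 / 2)) by (apply ln_le; lra). rewrite ln_1 in H; lra. }
pose (V := fun i => - signed_square (ln (INR i + 3 / 2) - c) + / 16 * / (INR i + 1) ^ 2).
destruct M as [|M]; [lia|clear hM].
change (S M) with (1 + M)%nat; rewrite rsum_add; simpl rsum at 1.
rewrite ln_1, Rdiv_1_r, Rabs_left1 by lra.
assert (s : rsum (fun i => Rabs (ln (INR (S (1 + i))) - c) / INR (S (1 + i))) M
            <= V 0%nat - V M).
{ rewrite <- rsum_telescope; apply rsum_le; intros i _.
  unfold V; change (1 + i)%nat with (S i); rewrite !S_INR; pose proof (pos_INR i).
  pose proof (log_midpoint c (INR i + 2)) as l.
  replace (INR i + 2 + / 2) with (INR i + 1 + 3 / 2) in l by field.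
  replace (INR i + 2 - / 2) with (INR i + 3 / 2) in l by field.
  replace (INR i + 2 - 1) with (INR i + 1) in l by ring.
  replace (INR i + 1 + 1) with (INR i + 2) by ring.
  specialize (l ltac:(lra)); lra. }
assert (v0 : V 0%nat = / 2 * (c - ln (3 / 2)) ^ 2 + / 16).
{ unfold V, signed_square; simpl INR; rewrite Rplus_0_l, Rabs_left1 by lra.
  field. }
assert (vM : - V M <= / 2 * (ln (INR (S (S M))) - c) ^ 2).
{ unfold V.
  assert (signed_square (ln (INR M + 3 / 2) - c)
          <= signed_square (ln (INR (S (S M))) - c)).
  { apply signed_square_le, Rplus_le_compat_r, ln_le; rewrite ?S_INR;
      pose proof (pos_INR M); lra. }
  unfold signed_square at 2 in H; rewrite Rabs_pos_eq in H by (simpl in *; lra).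
  assert (0 < / (INR M + 1) ^ 2).
  { apply Rinv_0_lt_compat; pose proof (pos_INR M); nra. }
  lra. }
change (S (1 + M)) with (S (S M)); lra.
Qed.

(** * From the weighted sums to the derivative *)

Lemma weighted_sum_bound (q : Z) (r : Z -> R) (x c : R) (H n : nat) :
  primitive_quadratic q r -> (0 < H <= Z.to_nat q)%nat -> IZR q <= INR H ^ 2 ->
  0.992 <= x <= 1 -> ln (3 / 2) <= c -> 1 <= x * (ln (INR (2 * H)) - c) ->
  Rabs (rsum (fun i => r (Z.of_nat (S i)) * weight x c (INR (S i))) (2 * H - 1 + n))
  <= Rpower (INR (2 * H)) (1 - x)
     * (c + / 2 * (ln (INR (2 * H)) - c) ^ 2 + / 2 * (c - ln (3 / 2)) ^ 2 + / 16
        + / 2 * (ln (INR (2 * H)) - c)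
        + 0.7072 * (2.02 * (ln (INR (2 * H)) - c) + 2.1)).
Proof.
intros pq [H0 HN] qH hx hc hl.
set (M := (2 * H)%nat) in *.
assert (RM : INR M = 2 * INR H) by (unfold M; rewrite mult_INR; simpl; ring).
assert (RH : 0 < INR H) by (apply (lt_INR 0); auto).
set (lam := ln (INR M) - c) in *.
set (E := Rpower (INR M) (1 - x)).
assert (lam0 : 0 <= lam) by nra.
assert (E0 : 0 < E) by apply exp_pos.
(* Index [i] stands for the integer [i + 1], so the first [M - 1] terms are exactly those below
   [M]. *)
rewrite rsum_add; eapply Rle_trans; [apply Rabs_triang|].
rewrite !Rplus_assoc, Rmult_plus_distr_l, !(Rmult_plus_distr_l E).
assert (head : Rabs (rsum (fun i => r (Z.of_nat (S i)) * weight x c (INR (S i))) (M - 1))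
  <= E * (c + / 2 * lam ^ 2 + / 2 * (c - ln (3 / 2)) ^ 2 + / 16)).
{ eapply Rle_trans; [apply rsum_abs|].
  apply Rle_trans with
    (rsum (fun i => E * (Rabs (ln (INR (S i)) - c) / INR (S i))) (M - 1)).
  - apply rsum_le; intros i hi.
    assert (S0 : 0 < INR (S i)) by (apply (lt_INR 0); lia).
    rewrite Rabs_mult; unfold weight.
    rewrite Rabs_mult, (Rabs_pos_eq (Rpower _ _)) by apply Rlt_le, exp_pos.
    apply Rle_trans with (1 * (Rpower (INR (S i)) (- x) * Rabs (ln (INR (S i)) - c))).
    + apply Rmult_le_compat_r; [|apply (pq_bound _ _ pq)].
      apply Rmult_le_pos; [apply Rlt_le, exp_pos|apply Rabs_pos].
    + replace (E * _) with (E / INR (S i) * Rabs (ln (INR (S i)) - c)) by (field; lra).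
      rewrite Rmult_1_l; apply Rmult_le_compat_r; [apply Rabs_pos|].
      replace (- x) with ((1 - x) + - (1)) by ring.
      rewrite Rpower_plus, Rpower_Ropp, Rpower_1 by auto.
      apply Rmult_le_compat_r; [apply Rlt_le, Rinv_0_lt_compat; auto|].
      apply Rle_Rpower_l; [lra|split; [auto|apply le_INR; lia]].
  - rewrite rsum_scal; apply Rmult_le_compat_l; [lra|].
    assert (sM : S (M - 1) = M) by (unfold M; lia).
    pose proof (log_sum_bound c (M - 1)) as b; rewrite sM in b.
    unfold lam in *; apply b; auto; [unfold M; lia|lra]. }
assert (tail : Rabs (rsum (fun i => r (Z.of_nat (S (M - 1 + i)))
    * weight x c (INR (S (M - 1 + i)))) n)
  <= E * (/ 2 * lam) + E * (0.7072 * (2.02 * lam + 2.1))).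
{ rewrite (rsum_ext _ (fun i => r (Z.of_nat (M + i)) * weight x c (INR (M + i)))).
  2:{ intros i _; replace (S (M - 1 + i)) with (M + i)%nat by (unfold M; lia); auto. }
  eapply Rle_trans.
  { apply (character_tail q r x c M H n pq); auto; [lra|unfold M; lia]. }
  assert (pM : 0 < INR M) by lra.
  apply Rplus_le_compat.
  - apply Req_le; unfold weight, E.
    replace (1 - x) with (1 + - x) by ring.
    rewrite Rpower_plus, Rpower_1 by auto.
    fold lam; rewrite RM at 2; field.
  - unfold weight_tail; fold lam.
    replace (1 / 2 - x) with ((1 - x) + - / 2) by field.
    rewrite Rpower_plus, Rpower_Ropp, Rpower_sqrt by auto; fold E.
    (* [x >= 0.992] gives [2 x - 1 >= 0.984], the source of 2.02 and 2.1. *)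
    assert (i1 : / (2 * x - 1) <= 1.02).
    { apply (Rmult_le_reg_l (2 * x - 1)); [lra|]; rewrite Rinv_r by lra; lra. }
    assert (i0 : 0 < / (2 * x - 1)) by (apply Rinv_0_lt_compat; lra).
    assert (i2 : 2 / (2 * x - 1) ^ 2 <= 2.1).
    { unfold Rdiv; rewrite <- pow_inv; nra. }
    assert (i3 : 0 < 2 / (2 * x - 1) ^ 2).
    { apply Rdiv_lt_0_compat; [lra|apply pow_lt; lra]. }
    set (w := lam * (1 + / (2 * x - 1)) + 2 / (2 * x - 1) ^ 2).
    assert (w0 : 0 <= w <= 2.02 * lam + 2.1) by (unfold w; split; nra).
    (* The product is [sqrt (q / (2 H^2))], at most [1 / sqrt 2] because [q <= H^2]. *)
    assert (k : sqrt (IZR q / INR H) * / sqrt (INR M) <= 0.7072).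
    { assert (Rq : 0 < IZR q) by (apply IZR_lt; pose proof (pq_gt1 _ _ pq); lia).
      rewrite <- sqrt_inv, <- sqrt_mult.
      - rewrite <- (sqrt_Rsqr 0.7072) by lra; apply sqrt_le_1_alt.
        rewrite RM; apply (Rmult_le_reg_r (2 * INR H ^ 2)); [nra|].
        replace (IZR q / INR H * / (2 * INR H) * (2 * INR H ^ 2)) with (IZR q) by (field; lra).
        unfold Rsqr; nra.
      - apply Rlt_le, Rdiv_lt_0_compat; auto.
      - apply Rlt_le, Rinv_0_lt_compat; auto. }
    assert (k0 : 0 <= sqrt (IZR q / INR H) * / sqrt (INR M)).
    { apply Rmult_le_pos; [apply sqrt_pos|].
      apply Rlt_le, Rinv_0_lt_compat, sqrt_lt_R0; auto. }
    replace (sqrt (IZR q / INR H) * (E * / sqrt (INR M) * w))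
      with (E * (sqrt (IZR q / INR H) * / sqrt (INR M) * w)) by ring.
    apply Rmult_le_compat_l; [lra|]; apply Rmult_le_compat; lra. }
lra.
Qed.

Definition partial_L (r : Z -> R) (n : nat) (x : R) : R :=
  rsum (fun i => r (Z.of_nat (S i)) * Rpower (INR (S i)) (- x)) n.

Definition real_L (r : Z -> R) (x : R) : R :=
  Series (fun i => r (Z.of_nat (S i)) * Rpower (INR (S i)) (- x)).

Lemma partial_L_derive (r : Z -> R) (n : nat) (c x : R) :
  is_derive (partial_L r n) x
    (- rsum (fun i => r (Z.of_nat (S i)) * weight x c (INR (S i))) n - c * partial_L r n x).
Proof.
unfold partial_L; induction n as [|n IH].
- simpl; replace (- 0 - c * 0) with 0 by ring; apply is_derive_Reals, derivable_pt_lim_const.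
- evar_last.
  + apply (is_derive_plus (V := R_NormedModule) _
      (fun t => r (Z.of_nat (S n)) * Rpower (INR (S n)) (- t)) x _
      (r (Z.of_nat (S n)) * (- ln (INR (S n)) * Rpower (INR (S n)) (- x))) IH).
    unfold Rpower; generalize (r (Z.of_nat (S n))) (ln (INR (S n))); intros a l.
    auto_derive; auto; ring.
  + unfold weight; cbn [rsum]; cbn -[INR Z.of_nat rsum]; ring.
Qed.

(* [P' + c P] is bounded, so [exp (c x) P x] varies slowly: Gronwall without differentiating
   the infinite series. *)
Lemma partial_L_lipschitz (r : Z -> R) (n : nat) (b c B u v : R) :
  0 <= c -> 0 <= B -> b <= u <= v ->
  (forall x, b <= x <= v ->
    Rabs (rsum (fun i => r (Z.of_nat (S i)) * weight x c (INR (S i))) n) <= B) ->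
  Rabs (partial_L r n v - partial_L r n u)
  <= (B * (1 + c * (v - b)) + c * Rabs (partial_L r n b)) * (v - u).
Proof.
intros c0 B0 [bu uv] hB.
set (P := partial_L r n) in *.
pose (Q := fun x => rsum (fun i => r (Z.of_nat (S i)) * weight x c (INR (S i))) n).
assert (dP : forall x, is_derive P x (- Q x - c * P x)) by (intros; apply partial_L_derive).
assert (size : forall x, b <= x <= v -> Rabs (P x) <= Rabs (P b) + B * (v - b)).
{ intros x hx.
  destruct (MVT_gen (fun t => exp (c * t) * P t) b x (fun t => - (exp (c * t) * Q t)))
    as [z [hz e]].
  - intros t _; auto_derive.
    + exists (- Q t - c * P t); apply dP.
    + replace (Derive (fun s => P s) t) with (- Q t - c * P t)
        by (symmetry; apply is_derive_unique, dP); ring.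
  - intros t _; apply continuity_pt_mult.
    + apply derivable_continuous_pt; exists (c * exp (c * t)).
      apply is_derive_Reals; auto_derive; auto; ring.
    + apply derivable_continuous_pt; exists (- Q t - c * P t); apply is_derive_Reals, dP.
  - rewrite Rmin_left, Rmax_right in hz by lra.
    assert (ex := exp_pos (c * x)).
    assert (mono : forall s, s <= x -> exp (c * s) <= exp (c * x)).
    { intros s hs; assert (l : c * s <= c * x) by (apply Rmult_le_compat_l; lra).
      destruct l as [l|l]; [apply Rlt_le, exp_increasing; auto|rewrite l; lra]. }
    apply (Rmult_le_reg_l (exp (c * x))); auto.
    rewrite <- (Rabs_pos_eq (exp (c * x))) at 1 by lra; rewrite <- Rabs_mult.
    replace (exp (c * x) * P x)
      with (exp (c * b) * P b + - (exp (c * z) * Q z) * (x - b)) by lra.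
    eapply Rle_trans; [apply Rabs_triang|].
    rewrite Rmult_plus_distr_l; apply Rplus_le_compat.
    + rewrite Rabs_mult, Rabs_pos_eq by apply Rlt_le, exp_pos.
      apply Rmult_le_compat_r; [apply Rabs_pos|apply mono; lra].
    + rewrite Rabs_mult, Rabs_Ropp, Rabs_mult, (Rabs_pos_eq (exp _)) by apply Rlt_le, exp_pos.
      rewrite (Rabs_pos_eq (x - b)), Rmult_assoc by lra.
      apply Rmult_le_compat.
      * apply Rlt_le, exp_pos.
      * apply Rmult_le_pos; [apply Rabs_pos|lra].
      * apply mono; lra.
      * apply Rmult_le_compat; try lra; [apply Rabs_pos|apply hB; lra]. }
destruct (MVT_gen P u v (fun t => - Q t - c * P t)) as [z [hz e]].
- intros t _; apply dP.
- intros t _; apply derivable_continuous_pt; exists (- Q t - c * P t).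
  apply is_derive_Reals, dP.
- rewrite Rmin_left, Rmax_right in hz by lra.
  rewrite e, Rabs_mult, (Rabs_pos_eq (v - u)) by lra.
  apply Rmult_le_compat_r; [lra|].
  eapply Rle_trans; [apply Rabs_triang|]; rewrite !Rabs_Ropp, Rabs_mult, (Rabs_pos_eq c) by auto.
  assert (Rabs (Q z) <= B) by (apply hB; lra).
  assert (c * Rabs (P z) <= c * (Rabs (P b) + B * (v - b)))
    by (apply Rmult_le_compat_l; auto; apply size; lra).
  lra.
Qed.

Lemma partial_L_cv (q : Z) (r : Z -> R) (x : R) :
  primitive_quadratic q r -> 0 < x -> is_lim_seq (fun n => partial_L r n x) (real_L r x).
Proof.
intros pq x0.
assert (cv : ex_finite_lim_seq (fun n => partial_L r n x)).
{ apply ex_lim_seq_cauchy_corr; intros eps.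
  assert (q0 : 0 < IZR q) by (apply IZR_lt; pose proof (pq_gt1 _ _ pq); lia).
  assert (tail : forall m n, Rabs (partial_L r (m + n) x - partial_L r m x)
    <= IZR q * Rpower (INR (S m)) (- x)).
  { intros m n; unfold partial_L; rewrite rsum_add.
    match goal with |- Rabs (?a + ?b - ?a) <= _ => replace (a + b - a) with b by ring end.
    pose proof (abel_bound_const (fun i => r (Z.of_nat (S m + i)))
      (fun i => Rpower (INR (S m + i)) (- x)) (IZR q) n) as a.
    cbv beta in a; rewrite Nat.add_0_r in a; apply a.
    - intros i; apply Rlt_le, exp_pos.
    - intros i; rewrite !Rpower_Ropp.
      apply Rinv_le_contravar; [apply exp_pos|].
      apply Rle_Rpower_l; [lra|split; [apply (lt_INR 0)|apply le_INR]; lia].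
    - intros t; apply character_sum_bound; auto. }
  (* Solution of [IZR q * w^(-x) = eps / 2]. *)
  pose (w := exp (- ln (eps / (2 * IZR q)) / x)).
  assert (e0 : 0 < eps / (2 * IZR q)) by (apply Rdiv_lt_0_compat; [apply cond_pos|lra]).
  assert (w0 : 0 < w) by apply exp_pos.
  destruct (archimed w) as [up1 _].
  exists (Z.to_nat (up w)).
  set (m := Z.to_nat (up w)).
  assert (small : IZR q * Rpower (INR (S m)) (- x) < eps / 2).
  { assert (wm : w < INR (S m)).
    { apply Rlt_le_trans with (1 := up1); rewrite INR_IZR_INZ; apply IZR_le; unfold m; lia. }
    apply ln_increasing in wm; auto; unfold w in wm; rewrite ln_exp in wm.
    assert (Rpower (INR (S m)) (- x) < eps / (2 * IZR q)).
    { unfold Rpower; rewrite <- (exp_ln (eps / (2 * IZR q))) by auto.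
      apply exp_increasing.
      apply (Rmult_lt_compat_r x) in wm; auto.
      replace (- ln (eps / (2 * IZR q)) / x * x) with (- ln (eps / (2 * IZR q))) in wm
        by (field; lra).
      lra. }
    apply (Rmult_lt_compat_l (IZR q)) in H; auto.
    replace (IZR q * (eps / (2 * IZR q))) with (eps / 2) in H by (field; lra); auto. }
  intros n p hn hp.
  pose proof (tail m (n - m)%nat) as tn; pose proof (tail m (p - m)%nat) as tp.
  replace (m + (n - m))%nat with n in tn by (unfold m in *; lia).
  replace (m + (p - m))%nat with p in tp by (unfold m in *; lia).
  replace (partial_L r n x - partial_L r p x)
    with ((partial_L r n x - partial_L r m x) - (partial_L r p x - partial_L r m x)) by ring.
  eapply Rle_lt_trans; [apply Rabs_triang|]; rewrite Rabs_Ropp; lra. }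
destruct cv as [l hl].
assert (sums : is_lim_seq (sum_n (fun i => r (Z.of_nat (S i)) * Rpower (INR (S i)) (- x))) l).
{ apply is_lim_seq_incr_1 in hl; revert hl; apply is_lim_seq_ext; intros n.
  induction n as [|n IH].
  - rewrite sum_O; unfold partial_L; simpl; ring.
  - rewrite sum_Sn, <- IH; reflexivity. }
unfold real_L, Series; rewrite (is_lim_seq_unique _ _ sums); auto.
Qed.

(** [Derive] unfolds to the limit of difference quotients along [h = 1 / (n + 1)], so a bound on
    right increments passes directly to its value. *)
Lemma Derive_bound (f : R -> R) (x K eps : R) :
  0 < eps -> (forall h, 0 < h < eps -> Rabs (f (x + h) - f x) <= K * h) ->
  Rabs (Derive f x) <= K.
Proof.
intros e0 hf; unfold Derive, Lim, Rbar_loc_seq.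
set (s := fun n : nat => _).
destruct (archimed (/ eps)) as [up1 _].
assert (ev : eventually (fun n => - K <= s n <= K)).
{ exists (Z.to_nat (up (/ eps))); intros n hn.
  assert (ie : 0 < / eps) by (apply Rinv_0_lt_compat; auto).
  assert (h : / eps < INR n + 1).
  { apply le_INR in hn; rewrite (INR_IZR_INZ (Z.to_nat _)), Z2Nat.id in hn; [lra|].
    apply le_IZR; lra. }
  assert (h0 : 0 < / (INR n + 1) < eps).
  { split; [apply Rinv_0_lt_compat; lra|].
    rewrite <- (Rinv_inv eps); apply Rinv_lt_contravar; auto; nra. }
  unfold s; rewrite Rplus_0_l; set (k := / (INR n + 1)) in *.
  apply Rabs_le_between; unfold Rdiv; rewrite Rabs_mult, Rabs_inv, (Rabs_pos_eq k) by lra.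
  apply (Rmult_le_reg_r k); [lra|]; rewrite Rmult_assoc, Rinv_l by lra.
  rewrite Rmult_1_r; apply hf; auto. }
assert (lo : Rbar_le (- K) (Lim_seq s)).
{ rewrite <- (Lim_seq_const (- K)); apply Lim_seq_le_loc.
  revert ev; apply filter_imp; intros n; tauto. }
assert (hi : Rbar_le (Lim_seq s) K).
{ rewrite <- (Lim_seq_const K); apply Lim_seq_le_loc.
  revert ev; apply filter_imp; intros n; tauto. }
destruct (Lim_seq s) as [l| |]; simpl in *; try tauto.
apply Rabs_le; auto.
Qed.

(** The offset [m] is there because the weighted bound covers partial sums of at least [2 H - 1]
    terms. In the limit the term [c * |P b|] disappears with the zero. *)
Lemma real_L_lipschitz (q : Z) (r : Z -> R) (b c B u v : R) (m : nat) :
  primitive_quadratic q r -> 0 < b -> 0 <= c -> 0 <= B -> b <= u <= v ->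
  (forall n x, b <= x <= v ->
    Rabs (rsum (fun i => r (Z.of_nat (S i)) * weight x c (INR (S i))) (m + n)) <= B) ->
  real_L r b = 0 ->
  Rabs (real_L r v - real_L r u) <= B * (1 + c * (v - b)) * (v - u).
Proof.
intros pq b0 c0 B0 hu hB z.
assert (cv : forall x, b <= x -> is_lim_seq (fun n => partial_L r (m + n) x) (real_L r x)).
{ intros x hx.
  apply (is_lim_seq_ext (fun n => partial_L r (n + m) x)).
  - intros n; rewrite Nat.add_comm; auto.
  - apply -> (is_lim_seq_incr_n (fun n => partial_L r n x)).
    apply (partial_L_cv q); auto; lra. }
assert (left : is_lim_seq (fun n => Rabs (partial_L r (m + n) v - partial_L r (m + n) u))
                 (Rabs (real_L r v - real_L r u))).
{ apply (is_lim_seq_abs _ (Finite _)), is_lim_seq_minus'; apply cv; lra. }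
assert (right : is_lim_seq (fun n => (v - u) *
    (B * (1 + c * (v - b)) + c * Rabs (partial_L r (m + n) b)))
    ((v - u) * (B * (1 + c * (v - b)) + c * Rabs (real_L r b)))).
{ apply (is_lim_seq_scal_l _ _ (Finite _)), is_lim_seq_plus'; [apply is_lim_seq_const|].
  apply (is_lim_seq_scal_l _ _ (Finite _)), (is_lim_seq_abs _ (Finite _)), cv; lra. }
rewrite z, Rabs_R0 in right.
pose proof (is_lim_seq_le _ _ _ _ (fun n => Rle_trans _ _ _
  (partial_L_lipschitz r (m + n) b c B u v c0 B0 hu (hB n))
  (Req_le _ _ (Rmult_comm _ _))) left right) as le; simpl in le; lra.
Qed.

(** * Numerical bounds for logarithms and the final constants *)

Lemma ln_2_bounds : 0.693 <= ln 2 <= 0.6945.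
Proof.
pose proof (ln_ratio_lower (/ 3)) as l; pose proof (ln_ratio_upper (/ 3)) as u.
replace ((1 + / 3) / (1 - / 3)) with 2 in l, u by field; lra.
Qed.

Lemma ln_5_4_lower : 0.223143 <= ln (5 / 4).
Proof.
pose proof (ln_ratio_lower (/ 9)) as l.
replace ((1 + / 9) / (1 - / 9)) with (5 / 4) in l by field; lra.
Qed.

Lemma ln_3_2_lower : 0.405 <= ln (3 / 2).
Proof.
pose proof (ln_ratio_lower (/ 5)) as l.
replace ((1 + / 5) / (1 - / 5)) with (3 / 2) in l by field; lra.
Qed.

(** The thresholds are exactly [2^17 (5/4)^5 = 4 * 10^5] and [2^21 (5/4)^7 = 10^7]. *)
Lemma ln_2_5_4 (m n : nat) : ln (2 ^ m * (5 / 4) ^ n) = INR m * ln 2 + INR n * ln (5 / 4).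
Proof. rewrite ln_mult, !ln_pow by (try apply pow_lt; lra); auto. Qed.

Lemma ln_gt_400000 (x : R) : 4 * 10 ^ 5 < x -> 12.896 <= ln x.
Proof.
intros h; pose proof ln_2_bounds; pose proof ln_5_4_lower.
assert (l : ln (2 ^ 17 * (5 / 4) ^ 5) <= ln x) by (apply ln_le; lra).
rewrite ln_2_5_4 in l; simpl in l; lra.
Qed.

Lemma ln_gt_10000000 (x : R) : 10 ^ 7 < x -> 16.11 <= ln x.
Proof.
intros h; pose proof ln_2_bounds; pose proof ln_5_4_lower.
assert (l : ln (2 ^ 21 * (5 / 4) ^ 7) <= ln x) by (apply ln_le; lra).
rewrite ln_2_5_4 in l; simpl in l; lra.
Qed.

(** The bracket of [weighted_sum_bound] at [c = L / 4 + 1]: [L / 4 - 0.303] bounds [ln M - c], and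
    [L / 4 + 0.595] bounds [c - ln (3 / 2)]. *)
Definition log_bound (L : R) : R :=
  L / 4 + 1 + / 2 * (L / 4 - 0.303) ^ 2 + / 2 * (L / 4 + 0.595) ^ 2 + / 16
  + / 2 * (L / 4 - 0.303) + 0.7072 * (2.02 * (L / 4 - 0.303) + 2.1).

(* With [L = log q], the constants bound [log_bound L] times
   [exp ((1 - beta0) log M) (1 + c (1 - beta0))], where [M = 2 ceil (sqrt q)] and
   [c = L / 4 + 1]. *)
Lemma real_L_derive_bound (q : Z) (r : Z -> R) (b s D k : R) :
  primitive_quadratic q r -> real_L r b = 0 -> b < s < 1 ->
  4 * 10 ^ 5 < IZR q -> 0 < D <= 800 ->
  b >= 1 - D / (sqrt (IZR q) * ln (IZR q) ^ 2) ->
  (1 + D * 4.02e-5) <= k * (1 - D * 6.81e-5) ->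
  Rabs (Derive (real_L r) s) <= k * log_bound (ln (IZR q)).
Proof.
intros pq z [bs s1] hq [D0 D800] hb hk.
set (L := ln (IZR q)) in *; set (w := sqrt (IZR q)) in *.
assert (hL : 12.896 <= L) by (apply ln_gt_400000; auto).
assert (ww : w * w = IZR q) by (apply sqrt_sqrt; lra).
assert (w_pos : 0 <= w) by apply sqrt_pos.
assert (hw : 632.45 <= w) by nra.
assert (lnw : ln w = L / 2).
{ unfold L; rewrite <- ww, ln_mult by lra; field. }
destruct (archimed w) as [up1 up2].
pose (H := Z.to_nat (up w)).
assert (upz : (0 < up w)%Z) by (apply lt_IZR; lra).
assert (HE : INR H = IZR (up w)) by (unfold H; rewrite INR_IZR_INZ, Z2Nat.id by lia; auto).
assert (HN : (0 < H <= Z.to_nat q)%nat).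
{ unfold H; assert (up w <= q)%Z; [|lia]. apply le_IZR; nra. }
pose (c := L / 4 + 1).
(* [up w] exceeds [w] by at most 1, so the excess over [L / 2] is at most [ln 2 + 1 / 632.45]. *)
assert (lnM : L / 2 + 0.693 <= ln (INR (2 * H)) <= L / 2 + 0.6962).
{ pose proof ln_2_bounds.
  rewrite mult_INR, HE; change (INR 2) with (1 + 1); replace (1 + 1) with 2 by ring.
  rewrite ln_mult by lra.
  assert (ln w <= ln (IZR (up w))) by (apply ln_le; lra).
  assert (u : ln (IZR (up w)) <= ln (w * (1 + / w))).
  { apply ln_le; [lra|].
    replace (w * (1 + / w)) with (w + 1) by (field; lra); lra. }
  assert (iw : 0 < / w <= / 632.45).
  { split; [apply Rinv_0_lt_compat; lra|apply Rinv_le_contravar; lra]. }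
  rewrite ln_mult in u by lra.
  assert (ln (1 + / w) <= / w).
  { pose proof (exp_ineq1_le (ln (1 + / w))) as e; rewrite exp_ln in e by lra; lra. }
  lra. }
pose proof ln_3_2_lower as l32.
assert (l32' : ln (3 / 2) <= 1).
{ pose proof (exp_ineq1_le (ln (3 / 2))) as e; rewrite exp_ln in e by lra; lra. }
assert (delta : 1 - b <= D / (632.45 * L ^ 2)).
{ assert (D / (w * L ^ 2) <= D / (632.45 * L ^ 2)); [|lra].
  apply Rmult_le_compat_l; [lra|]; apply Rinv_le_contravar; nra. }
assert (iL : / L <= / 12.896) by (apply Rinv_le_contravar; lra).
assert (iL0 : 0 < / L) by (apply Rinv_0_lt_compat; lra).
replace (D / (632.45 * L ^ 2)) with (D / 632.45 * (/ L * / L)) in delta by (field; lra).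
assert (dL : (1 - b) * L <= D / 632.45 * / L).
{ replace (D / 632.45 * / L) with (D / 632.45 * (/ L * / L) * L) by (field; lra).
  apply Rmult_le_compat_r; lra. }
assert (iL2 : / L * / L <= / 12.896 * / 12.896) by (apply Rmult_le_compat; lra).
(* [9.508e-6] and [1.22611e-4] are [1 / (632.45 * 12.896^2)] and [1 / (632.45 * 12.896)] rounded up.
   They yield [6.81e-5] for [(1 - b) (L / 2 + 0.6962)] and [4.02e-5] for [c (1 - b)], per unit of
   [D]. *)
assert (d1 : (1 - b) <= D * 9.508e-6).
{ apply Rle_trans with (1 := delta).
  apply Rle_trans with (D / 632.45 * (/ 12.896 * / 12.896)); [apply Rmult_le_compat_l|]; lra. }
assert (d2 : (1 - b) * L <= D * 1.22611e-4).
{ apply Rle_trans with (1 := dL).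
  apply Rle_trans with (D / 632.45 * / 12.896); [apply Rmult_le_compat_l|]; lra. }
assert (dM : forall x, b <= x <= 1 -> (1 - x) * ln (INR (2 * H)) <= D * 6.81e-5).
{ intros x hx; apply Rle_trans with ((1 - b) * (L / 2 + 0.6962)); [|lra].
  apply Rmult_le_compat; lra. }
(* From [exp (- t) >= 1 - t], inverted. *)
assert (EM : forall x, b <= x <= 1 ->
  Rpower (INR (2 * H)) (1 - x) <= / (1 - D * 6.81e-5)).
{ intros x hx; unfold Rpower; specialize (dM x hx).
  set (t := (1 - x) * ln (INR (2 * H))) in *.
  pose proof (exp_ineq1_le (- t)); rewrite <- (Rinv_inv (exp t)), <- exp_Ropp.
  apply Rinv_le_contravar; lra. }
assert (lam : 2.9 <= ln (INR (2 * H)) - c <= L / 4 - 0.303) by (unfold c; lra).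
assert (B0 : 0 <= log_bound L).
{ unfold log_bound.
  pose proof (pow2_ge_0 (L / 4 - 0.303)); pose proof (pow2_ge_0 (L / 4 + 0.595)); lra. }
assert (F : 0 < / (1 - D * 6.81e-5)) by (apply Rinv_0_lt_compat; lra).
assert (hB : forall n x, b <= x <= 1 ->
  Rabs (rsum (fun i => r (Z.of_nat (S i)) * weight x c (INR (S i))) (2 * H - 1 + n))
  <= / (1 - D * 6.81e-5) * log_bound L).
{ intros n x hx.
  eapply Rle_trans.
  { apply (weighted_sum_bound q r x c H n); auto.
    - rewrite HE; nra.
    - lra.
    - unfold c; lra.
    - nra. }
  set (l := ln (INR (2 * H)) - c) in *.
  apply Rmult_le_compat; [apply Rlt_le, exp_pos| |apply EM; auto|].
  - pose proof (pow2_ge_0 l); pose proof (pow2_ge_0 (c - ln (3 / 2))); unfold c in *; lra.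
  - unfold log_bound.
    assert (l ^ 2 <= (L / 4 - 0.303) ^ 2) by (apply pow_incr; lra).
    assert ((c - ln (3 / 2)) ^ 2 <= (L / 4 + 0.595) ^ 2)
      by (apply pow_incr; unfold c; lra).
    unfold c at 1; lra. }
assert (K : forall u v, b <= u <= v -> v <= 1 ->
  Rabs (real_L r v - real_L r u) <= k * log_bound L * (v - u)).
{ intros u v huv v1.
  eapply Rle_trans.
  { apply (real_L_lipschitz q r b c (/ (1 - D * 6.81e-5) * log_bound L) u v (2 * H - 1));
      auto; try (unfold c; lra).
    - apply Rmult_le_pos; lra.
    - intros n x hx; apply hB; lra. }
  apply Rmult_le_compat_r; [lra|].
  replace (/ (1 - D * 6.81e-5) * log_bound L * (1 + c * (v - b)))
    with (/ (1 - D * 6.81e-5) * (1 + c * (v - b)) * log_bound L) by ring.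
  apply Rmult_le_compat_r; auto.
  apply (Rmult_le_reg_l (1 - D * 6.81e-5)); [lra|].
  rewrite <- Rmult_assoc, Rinv_r, Rmult_1_l by lra.
  assert (c * (v - b) <= c * (1 - b)) by (apply Rmult_le_compat_l; unfold c; lra).
  unfold c in *; lra. }
apply (Derive_bound _ _ _ (1 - s)); [lra|]; intros h hh.
pose proof (K s (s + h)) as k'; replace (s + h - s) with h in k' by ring; apply k'; lra.
Qed.

(** * Return to the complex L-function and conclusion *)

Lemma L_function_real (chi : Z -> C) (x : R) :
  real_character chi ->
  L_function chi (RtoC x) = RtoC (real_L (fun n => Re (chi n)) x).
Proof.
intros re; unfold L_function, real_L, RtoC.
assert (t : forall k, (chi (Z.of_nat (S k)) * nat_cpow_opp (S k) (RtoC x))%C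
  = RtoC (Re (chi (Z.of_nat (S k))) * Rpower (INR (S k)) (- x))).
{ intros k; unfold nat_cpow_opp; cbn [Re Im RtoC fst snd].
  rewrite Rmult_0_l, cos_0, sin_0; specialize (re (Z.of_nat (S k))).
  unfold Cmult, RtoC, Re, Im in *; cbn [fst snd]; rewrite re.
  apply injective_projections; cbn [fst snd]; ring. }
apply injective_projections; cbn [fst snd].
- apply Series_ext; intros k; fold (RtoC x); rewrite t; auto.
- rewrite (Series_ext _ (fun k => 0 * 0)).
  + rewrite Series_scal_l; ring.
  + intros k; fold (RtoC x); rewrite t; cbn [Im RtoC snd]; ring.
Qed.

Lemma Cmod_L_derivative (chi : Z -> C) (x : R) :
  real_character chi ->
  Cmod (L_derivative chi x) = Rabs (Derive (real_L (fun n => Re (chi n))) x).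
Proof.
intros re; rewrite <- Cmod_R; f_equal; unfold L_derivative, RtoC at 3.
apply injective_projections; cbn [fst snd].
- apply Derive_ext; intros t; rewrite L_function_real; auto.
- rewrite <- (Derive_const 0 x); apply Derive_ext; intros t.
  rewrite L_function_real; auto.
Qed.

Theorem theorem1p2 :
  forall (q : Z) (chi : Z -> C) (beta0 sigma : R),
    primitive_character q chi ->
    real_character chi ->
    exceptional_zero q chi beta0 ->
    beta0 < sigma < 1 ->
    (odd_character chi ->
     IZR q > 4 * 10 ^ 5 ->
     beta0 >= 1 - 800 / (sqrt (IZR q) * (ln (IZR q)) ^ 2) ->
     Cmod (L_derivative chi sigma) <= 0.18 * (ln (IZR q)) ^ 2)
    /\
    (even_character chi ->
     IZR q > 4 * 10 ^ 5 ->
     beta0 >= 1 - 515 / (sqrt (IZR q) * (ln (IZR q)) ^ 2) ->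
     Cmod (L_derivative chi sigma) <= 0.1536 * (ln (IZR q)) ^ 2)
    /\
    (even_character chi ->
     IZR q > 10 ^ 7 ->
     beta0 >= 1 - 80 / (sqrt (IZR q) * (ln (IZR q)) ^ 2) ->
     Cmod (L_derivative chi sigma) <= 0.15 * (ln (IZR q)) ^ 2).
Proof.
intros q chi b s prim re [_ zero] hs.
rewrite Cmod_L_derivative by auto.
rewrite L_function_real in zero by auto; apply RtoC_inj in zero.
assert (main : forall D k, 4 * 10 ^ 5 < IZR q -> 0 < D <= 800 ->
  b >= 1 - D / (sqrt (IZR q) * ln (IZR q) ^ 2) ->
  1 + D * 4.02e-5 <= k * (1 - D * 6.81e-5) ->
  Rabs (Derive (real_L (fun n => Re (chi n))) s) <= k * log_bound (ln (IZR q))).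
{ intros D k hq; intros; apply (real_L_derive_bound q _ b s D k); auto.
  apply primitive_quadratic_Re; auto; apply lt_IZR; lra. }
(* The least admissible [k] is [(1 + D * 4.02e-5) / (1 - D * 6.81e-5)]: about 1.0917 for [D = 800]
   and 1.0578 for [D = 515]. The value 1.0582 also serves [D = 80]. What remains is a quadratic
   inequality in [L]. *)
split; [|split]; intros _ hq hb.
- eapply Rle_trans; [apply (main 800 1.0919); auto; lra|].
  pose proof (ln_gt_400000 _ hq); unfold log_bound; nra.
- eapply Rle_trans; [apply (main 515 1.0582); auto; lra|].
  pose proof (ln_gt_400000 _ hq); unfold log_bound; nra.
- eapply Rle_trans; [apply (main 80 1.0582); auto; lra|].
  pose proof (ln_gt_10000000 _ hq); unfold log_bound; nra.
Qed.
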